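(* Let $\mathcal{X}\subseteq\mathbb{R}^d$ be closed, $A\subseteq\mathbb{R}^m$ compact and nonempty ($d,m\in\mathbb{N}$), $q\in\mathbb{N}$, $\varepsilon>0$, $\alpha\in(0,1)$. Let $r:\mathcal{X}\times A\times\mathcal{X}\to\mathbb{R}$ be a reward function, let $\widehat{\mathbb{P}}:\mathcal{X}\times A\to\mathcal{M}_1^q(\mathcal{X})$ be the reference kernel and $\mathbb{P}^{\mathrm{true}}:\mathcal{X}\times A\to\mathcal{M}_1^q(\mathcal{X})$ the true kernel, and let $\mathcal{P}(x,a)$ be the $q$-Wasserstein ball of radius $\varepsilon$ around $\widehat{\mathbb{P}}(x,a)$. Assume that $r$, $\widehat{\mathbb{P}}$, $\alpha$ and $\mathbb{P}^{\mathrm{true}}$ satisfy Assumptions (A1)-(A4) listed in the context, with Lipschitz constants $L_r>0$ for $r$ and $0\le L_P<1/\alpha$ for $\mathbb{P}^{\mathrm{true}}$. Let $V$ and $V^{\mathrm{true}}$ be the robust and non-robust value functions defined in the context. (i) For every $x_0\in\mathcal{X}$, $$0\le V^{\mathrm{true}}(x_0)-V(x_0)\le 2L_r\,\varepsilon\,(1+\alpha)\sum_{i=0}^\infty\alpha^i\sum_{j=0}^i (L_P)^j<\infty .$$ (ii) If moreover $\mathbb{P}^{\mathrm{true}}=\widehat{\mathbb{P}}$, then for every $x_0\in\mathcal{X}$, $$0\le V^{\mathrm{true}}(x_0)-V(x_0)\le L_r\,\varepsilon\,(1+\alpha)\sum_{i=0}^\infty\alpha^i\sum_{j=0}^i (L_P)^j<\infty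 .$$
   Context: Notation. $\|\cdot\|$ is the Euclidean norm. $\mathcal{X}$ carries its Borel $\sigma$-field; $\Omega:=\mathcal{X}^{\mathbb{N}_0}$ carries the product $\sigma$-field $\mathcal{F}$, and $X_t(\omega):=\omega_t$ for $\omega=(\omega_0,\omega_1,\dots)\in\Omega$, $t\in\mathbb{N}_0$, is the canonical process. $\mathcal{M}_1^q(\mathcal{X})$ is the set of Borel probability measures on $\mathcal{X}$ with finite $q$-th moment, and $\mathcal{M}_1(\mathcal{X}):=\mathcal{M}_1^1(\mathcal{X})$. The $q$-Wasserstein distance is $$d_{W_q}(\mathbb{P}_1,\mathbb{P}_2):=\Big(\inf_{\pi\in\Pi(\mathbb{P}_1,\mathbb{P}_2)}\int_{\mathcal{X}\times\mathcal{X}}\|x-y\|^q\,d\pi(x,y)\Big)^{1/q},$$ where $\Pi(\mathbb{P}_1,\mathbb{P}_2)$ is the set of joint distributions (couplings) of $\mathbb{P}_1$ and $\mathbb{P}_2$. $\tau_q$ is the topology on $\mathcal{M}_1^q(\mathcal{X})$ induced by $d_{W_q}$. Convention: $(L_P)^0=1$, also when $L_P=0$. Controls. $\mathcal{A}$ is the set of sequences $\mathbf{a}=(a_t(X_t))_{t\in\mathbb{N}_0}$ with each $a_t:\mathcal{X}\to A$ Borel measurable. Ambiguity set. For $(x,a)\in\mathcal{X}\times A$, $$\mathcal{P}(x,a):=\{\mathbb{P}\in\mathcal{M}_1(\mathcal{X}) : d_{W_q}(\mathbb{P},\widehat{\mathbb{P}}(x,a))\le\varepsilon\}.$$ For $x\in\mathcal{X}$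 and $\mathbf{a}\in\mathcal{A}$, $\mathfrak{P}_{x,\mathbf{a}}$ is the set of all probability measures $\delta_x\otimes\mathbb{P}_0\otimes\mathbb{P}_1\otimes\cdots$ on $(\Omega,\mathcal{F})$ such that for all $t\in\mathbb{N}_0$ the map $\mathbb{P}_t:\mathcal{X}\to\mathcal{M}_1(\mathcal{X})$ is Borel measurable and $\mathbb{P}_t(\omega_t)\in\mathcal{P}(\omega_t,a_t(\omega_t))$ for all $\omega_t\in\mathcal{X}$. Here $\delta_x\otimes\mathbb{P}_0\otimes\mathbb{P}_1\otimes\cdots$ is the law on $\Omega$ under which $X_0=x$ and the transition from time $t$ to time $t+1$ is given by the kernel $\mathbb{P}_t(\omega_t;d\omega_{t+1})$, i.e. $$\mathbb{P}(B)=\int_{\mathcal{X}}\cdots\int_{\mathcal{X}}\cdots \mathbf{1}_B\big((\omega_t)_{t\in\mathbb{N}_0}\big)\cdots\mathbb{P}_{t-1}(\omega_{t-1};d\omega_t)\cdots\mathbb{P}_0(\omega_0;d\omega_1)\,\delta_x(d\omega_0),\qquad B\in\mathcal{F}.$$ Value functions. For $x\in\mathcal{X}$, $$V(x):=\sup_{\mathbf{a}\in\mathcal{A}}\ \inf_{\mathbb{P}\in\mathfrak{P}_{x,\mathbf{a}}}\mathbb{E}_{\mathbb{P}}\Big[\sum_{t=0}^\infty\alpha^t r(X_t,a_t(X_t),X_{t+1})\Big],\qquad V^{\mathrm{true}}(x):=\sup_{\mathbf{a}\in\mathcal{A}}\mathbb{E}_{\mathbb{P}^{\mathrm{true}}_{x,\mathbf{a}}}\Big[\sum_{t=0}^\infty\alpha^t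 r(X_t,a_t(X_t),X_{t+1})\Big],$$ where $\mathbb{P}^{\mathrm{true}}_{x,\mathbf{a}}:=\delta_x\otimes\mathbb{P}^{\mathrm{true}}\otimes\mathbb{P}^{\mathrm{true}}\otimes\cdots$ is the law on $\Omega$ with $X_0=x$ and transition from time $t$ to $t+1$ given by $\mathbb{P}^{\mathrm{true}}(\omega_t,a_t(\omega_t))(d\omega_{t+1})$. Assumptions. (A1) (reward) (i) $r$ is Lipschitz continuous with constant $L_r>0$: $|r(x_0,a,x_1)-r(x_0',a',x_1')|\le L_r(\|x_0-x_0'\|+\|a-a'\|+\|x_1-x_1'\|)$ for all arguments. (ii) If $\mathcal{X}$ is unbounded and $q=1$, then additionally $\sup_{x_0,x_1\in\mathcal{X},\,a\in A}|r(x_0,a,x_1)|<\infty$. (A2) (center) (i) The map $(x,a)\mapsto\widehat{\mathbb{P}}(x,a)\in(\mathcal{M}_1^q(\mathcal{X}),\tau_q)$ is continuous. (i+) If $r$ is unbounded, then instead of (i) the following stronger condition is assumed: there is $L_{\widehat{\mathbb{P}}}>0$ with $d_{W_q}(\widehat{\mathbb{P}}(x,a),\widehat{\mathbb{P}}(x',a'))\le L_{\widehat{\mathbb{P}}}(\|x-x'\|+\|a-a'\|)$ for all $x,x'\in\mathcal{X}$, $a,a'\in A$. (A3) (discount factor) $0<\alpha<1/C_P$, where $1\le C_P<\infty$ is defined by $$C_P:=\max\Big\{1+\varepsilon+\sup_{a\in A}\inf_{x\in\mathcal{X}}\Big\{\int_{\mathcal{X}}\|z\|\,\widehat{\mathbb{P}}(x,a)(dz)+L_{\widehat{\mathbb{P}}}\|x\|\Big\},\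 L_{\widehat{\mathbb{P}}}\Big\}$$ if $r$ is unbounded, and $C_P:=1$ otherwise. (A4) (true kernel) (i) $\mathbb{P}^{\mathrm{true}}(x,a)\in\mathcal{P}(x,a)$ for all $(x,a)\in\mathcal{X}\times A$. (ii) There is a constant $0\le L_P<1/\alpha$ with $d_{W_q}(\mathbb{P}^{\mathrm{true}}(x,a),\mathbb{P}^{\mathrm{true}}(x',a'))\le L_P(\|x-x'\|+\|a-a'\|)$ for all $x,x'\in\mathcal{X}$, $a,a'\in A$. *)

(* Defs.v *)
From HB Require Import structures.
From mathcomp Require Import all_boot all_order all_algebra.
From mathcomp Require Import all_classical all_reals all_analysis.

Set Implicit Arguments.
Unset Strict Implicit.
Unset Printing Implicit Defensive.

Import Order.TTheory GRing.Theory Num.Theory.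
Import numFieldNormedType.Exports.

Local Open Scope classical_set_scope.
Local Open Scope ring_scope.

(* The norm that the library puts on 'rV[R]_n is the sup norm. *)
Definition enorm (R : realType) (n : nat) (v : 'rV[R]_n) : R :=
  Num.sqrt (\sum_(i < n) v ord0 i ^+ 2).

(* A nonempty subset of R^n as a type, with the subspace topology and the
   Borel sigma-algebra.  Measurable types are pointed, hence the argument E0;
   it only fixes
   the value of otherwise undefined expressions. *)
Definition borel_subspace (R : realType) (n : nat) (E : set 'rV[R]_n)
  (E0 : E !=set0) : Type := set_type E.

Section borel_subspace.
Context (R : realType) (n : nat) (E : set 'rV[R]_n) (E0 : E !=set0).

HB.instance Definition _ := Topological.copy (borel_subspace E0) (set_type E).
HB.instance Definition _ :=
  isPointed.Build (borel_subspace E0) (SigSub (mem_set (svalP (cid E0)))).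
HB.instance Definition _ := @isMeasurable.Build
  (sigma_display (@open (borel_subspace E0))) (borel_subspace E0)
  (<<s (@open (borel_subspace E0)) >>) (@sigma_algebra0 _ setT _)
  (@sigma_algebraC _ _) (@sigma_algebra_bigcup _ setT _).

Definition pnorm (x : borel_subspace E0) : R := enorm (set_val x).

Definition pdist (x y : borel_subspace E0) : R := enorm (set_val x - set_val y).

End borel_subspace.

Section wasserstein.
Context (R : realType) (n : nat) (E : set 'rV[R]_n) (E0 : E !=set0).
Local Notation S := (borel_subspace E0).
Implicit Types P : probability S R.

Definition coupling P1 P2 : set (probability (S * S)%type R) :=
  [set pi | forall B : set S, measurable B ->
     pi (B `*` setT) = P1 B /\ pi (setT `*` B) = P2 B].

Definition wass (q : nat) P1 P2 : \bar R :=
  (ereal_inf [set \int[pi]_z ((pdist z.1 z.2 ^+ q)%:E)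
             | pi in coupling P1 P2] `^ (q%:R^-1))%E.

Definition finite_moment (q : nat) : set (probability S R) :=
  [set P | (\int[P]_x ((pnorm x ^+ q)%:E) < +oo)%E].

Definition wspace (q : nat) : Type := set_type (finite_moment q).

Definition wmeasure (q : nat) (P : wspace q) : probability S R := set_val P.

End wasserstein.
Arguments finite_moment {R n E} E0 q.
Coercion wmeasure : wspace >-> Probability.type.

Section wasserstein_topology.
Context (R : realType) (n : nat) (E : set 'rV[R]_n) (E0 : E !=set0) (q : nat).

HB.instance Definition _ :=
  Choice.copy (wspace E0 q) (set_type (finite_moment E0 q)).

Definition wass_open : set_system (wspace E0 q) :=
  [set U | forall P : wspace E0 q, U P ->
     exists2 e : R, 0 < e & forall Q : wspace E0 q, (wass q P Q < e%:E)%E -> U Q].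

Let wass_openT : wass_open setT.
Proof. by move=> P _; exists 1. Qed.

Let wass_openI : setI_closed wass_open.
Proof.
move=> U V oU oV P [/oU[e e0 eU] /oV[f f0 fV]].
exists (Num.min e f); first by rewrite lt_min e0 f0.
move=> Q PQ; split; [apply: eU|apply: fV]; apply: (lt_le_trans PQ);
  by rewrite lee_fin ge_min lexx ?orbT.
Qed.

Let wass_open_bigU (I : Type) (f : I -> set (wspace E0 q)) :
  (forall i, wass_open (f i)) -> wass_open (\bigcup_i f i).
Proof.
move=> of_ P [i _ /of_[e e0 eU]]; exists e => // Q /eU fQ.
by exists i.
Qed.

HB.instance Definition _ := isOpenTopological.Build (wspace E0 q)
  wass_openT wass_openI wass_open_bigU.

End wasserstein_topology.

(* Measurability for the Borel sigma-algebra of T; T need not be pointed. *)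
Definition borel_measurable d (S : measurableType d) (T : topologicalType)
    (f : S -> T) : Prop :=
  forall B : set T, <<s open >> B -> measurable (f @^-1` B).

Section canonical_space.
Context (R : realType) (n : nat) (E : set 'rV[R]_n) (E0 : E !=set0).
Local Notation S := (borel_subspace E0).

Definition trajectory : Type := g_sigma_algebraType
  [set ((fun w : nat -> S => w t) @^-1` B) | t in [set: nat] & B in measurable].

HB.instance Definition _ := Measurable.on trajectory.

(* The integral of f over coordinates s + 1, ..., s + k of w, coordinate
   t + 1 being drawn from K t (w t). *)
Fixpoint iterated_integral (K : nat -> S -> probability S R) (s k : nat)
    (f : trajectory -> \bar R) (w : trajectory) : \bar R :=
  if k is k'.+1 then
    (\int[K s (w s)]_y
       iterated_integral K s.+1 k' f [eta w with s.+1 |-> y])%E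
  else f w.

(* The defining formula of the law of the process started at x with kernels
   K t, on the events that depend on coordinates 0, ..., k only.  For these,
   all but k of the infinitely many integrals are trivial, and the coordinates
   of the constant path beyond 0 are immaterial.  These events generate the
   product sigma-algebra and are stable under intersection, so P is determined
   on it; for measurable kernels P exists by the Ionescu-Tulcea theorem. *)
Definition is_kernel_law (x : S) (K : nat -> S -> probability S R)
    (P : probability trajectory R) : Prop :=
  forall (k : nat) (B : set trajectory), measurable B ->
    (forall w w' : trajectory, (forall i, (i <= k)%N -> w i = w' i) ->
       B w -> B w') ->
    P B = iterated_integral K 0 k (fun w => (\1_B w)%:E) (cst x).

(* get picks an element of the set; see above for its nonemptiness. *)
Definition kernel_law (x : S) (K : nat -> S -> probability S R) :
  probability trajectory R := get (is_kernel_law x K).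

End canonical_space.

Section markov_decision.
Context (R : realType) (d m q : nat).
Context (X : set 'rV[R]_d) (A : set 'rV[R]_m).
Context (X0 : X !=set0) (A0 : A !=set0).
Local Notation SX := (borel_subspace X0).
Local Notation SA := (borel_subspace A0).
Implicit Types (r : SX -> SA -> SX -> R).
Implicit Types (Phat Ptrue : SX -> SA -> wspace X0 q).

Definition control : set (nat -> SX -> SA) :=
  [set a | forall t, measurable_fun [set: SX] (a t)].

Definition ambiguity Phat (eps : R) (x : SX) (a : SA) :
    set (probability SX R) :=
  [set P | finite_moment X0 1 P /\ (wass q P (Phat x a) <= eps%:E)%E].

Definition ambiguity_law Phat (eps : R) (x : SX) (a : nat -> SX -> SA) :
    set (probability (trajectory X0) R) :=
  [set kernel_law x (fun t y => K t y)
  | K in [set K : nat -> SX -> wspace X0 1 | forall t,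
      borel_measurable (K t) /\
      forall y, ambiguity Phat eps y (a t y) (K t y)]].

Definition true_law Ptrue (x : SX) (a : nat -> SX -> SA) :
    probability (trajectory X0) R :=
  kernel_law x (fun t y => Ptrue y (a t y)).

Definition total_reward r (alpha : R) (a : nat -> SX -> SA)
    (w : trajectory X0) : R :=
  limn (series (fun t => alpha ^+ t * r (w t) (a t (w t)) (w t.+1))).

Definition robust_value r Phat (eps alpha : R) (x : SX) : \bar R :=
  ereal_sup [set ereal_inf [set ('E_P[total_reward r alpha a])%E
                           | P in ambiguity_law Phat eps x a]
            | a in control].

Definition true_value r Ptrue (alpha : R) (x : SX) : \bar R :=
  ereal_sup [set ('E_(true_law Ptrue x a)[total_reward r alpha a])%E
            | a in control].

Definition bounded_reward r : Prop :=
  exists M : R, forall x a y, `|r x a y| <= M.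

Definition bounded_state : Prop :=
  exists M : R, forall x : SX, pnorm x <= M.

Definition reward_assumption r (Lr : R) : Prop :=
  [/\ 0 < Lr,
      forall x a y x' a' y', `|r x a y - r x' a' y'| <=
        Lr * (pdist x x' + pdist a a' + pdist y y')
    & ~ bounded_state -> q = 1%N -> bounded_reward r].

Definition kernel_lipschitz Phat (L : R) : Prop :=
  forall x a x' a', (wass q (Phat x a) (Phat x' a') <=
    (L * (pdist x x' + pdist a a'))%:E)%E.

Definition center_assumption r Phat (LPhat : R) : Prop :=
  (bounded_reward r ->
     continuous (fun z : SX * SA => Phat z.1 z.2)) /\
  (~ bounded_reward r -> 0 < LPhat /\ kernel_lipschitz Phat LPhat).

Definition growth_const r Phat (eps LPhat : R) : \bar R :=
  if `[< bounded_reward r >] then 1%E else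
  maxe (1 + eps%:E + ereal_sup
          [set ereal_inf
             [set (\int[Phat x a]_z (pnorm z)%:E + (LPhat * pnorm x)%:E)%E
             | x in [set: SX]]
          | a in [set: SA]])%E
       LPhat%:E.

(* If growth_const is +oo, its inverse is 0 and the condition fails. *)
Definition discount_assumption r Phat (eps alpha LPhat : R) : Prop :=
  (0 < alpha%:E < (growth_const r Phat eps LPhat)^-1)%E.

Definition true_kernel_assumption Phat Ptrue (eps alpha LP : R) : Prop :=
  [/\ forall x a, ambiguity Phat eps x a (Ptrue x a),
      0 <= LP < alpha^-1
    & kernel_lipschitz Ptrue LP].

(* Measures are functions on all sets, so equality of measures is stated on
   measurable sets. *)
Definition kernel_eq Ptrue Phat : Prop :=
  forall x a (B : set SX), measurable B -> Ptrue x a B = Phat x a B.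

End markov_decision.

(* LP ^+ 0 is 1 also for LP = 0. *)
Definition gap_series (R : realType) (alpha LP : R) : \bar R :=
  (\sum_(0 <= i <oo) (alpha ^+ i * \sum_(0 <= j < i.+1) LP ^+ j)%:E)%E.

(* Main.v *)
(** Let [v_0 = 0] and let [v_(n+1)] be the image of [v_n] under the Bellman
    operator of the true kernel.  All [v_n] are [L]-Lipschitz for the solution [L]
    of [L = Lr + (Lr + alpha L) LP], so the function [r(x,a,.) + alpha v_n] is
    [Lr + alpha L = Lr (1 + alpha) / (1 - alpha LP)]-Lipschitz.  By the easy half of
    Kantorovich duality, replacing the true kernel by one in the ambiguity set
    changes its integral by at most [Lr + alpha L] times [2 eps] (through the
    centre of the ball), or times [eps] if the true kernel is the centre.

    For every control, the true reward over [N] steps is at most [v_N].  A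
    measurable control that is greedy for the [v_n] up to [delta] earns against
    every kernel of the ambiguity set at least
    [v_N - (2 eps (Lr + alpha L) + delta) / (1 - alpha)] over [N] steps.  The rest of
    the reward is uniformly small as [N] grows, because a weight function ([1] if
    [r] is bounded, [1 + |x|] otherwise) grows by at most the factor [C_P] per step.
    Letting [N] grow and [delta] tend to 0 gives the claim, since the double series
    equals [1 / ((1 - alpha) (1 - alpha LP))].

    The law of the process is the Caratheodory extension of a content on cylinder
    sets (Ionescu-Tulcea). *)

From HB Require Import structures.
Require Import Defs.
From mathcomp Require Import all_boot all_order all_algebra.
From mathcomp Require Import all_classical all_reals all_analysis.
From mathcomp Require Import measurable_realfun ring lra.

Set Implicit Arguments.
Unset Strict Implicit.
Unset Printing Implicit Defensive.

Import Order.TTheory GRing.Theory Num.Theory.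
Import numFieldNormedType.Exports.

Local Open Scope classical_set_scope.
Local Open Scope ring_scope.

(** * Euclidean geometry *)

(** The control is built from the true model alone and then tested against every kernel of the
    ambiguity set. This is why all Lipschitz estimates concern the true kernel: the competing
    kernels are only measurable in the state, and the centre is only assumed continuous when r is
    bounded. Working with the iterates v_N, instead of a fixed point, leaves a tail that is bounded
    by a multiple of (alpha C)^N depending on the starting point, but neither on the control nor on
    the kernel. Two points cost more than the estimates. A law of the process is chosen by [get], so
    nothing can be said about it before a law with the defining property is constructed. And 0 <=
    V^true - V requires the true law to belong to the ambiguity set: y -> Ptrue(y, a(y)) has to be
    Borel for the Wasserstein topology although the control a is only measurable. This comes from
    the Lipschitz continuity of the true kernel and the separability of A. Conversely, Borel
    measurability for that topology has to be turned into measurability of y -> K(y)(B) before any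
    integral can be iterated. *)

Section euclidean_norm.
Context {R : realType} {n : nat}.
Implicit Types u v : 'rV[R]_n.

Lemma enorm_ge0 v : 0 <= enorm v. Proof. exact: sqrtr_ge0. Qed.

Lemma enorm_sqr v : enorm v ^+ 2 = \sum_(i < n) v ord0 i ^+ 2.
Proof. by rewrite sqr_sqrtr// sumr_ge0// => i _; exact: sqr_ge0. Qed.

Lemma enorm0 : enorm (0 : 'rV[R]_n) = 0.
Proof.
rewrite /enorm big1 ?sqrtr0// => i _.
by rewrite mxE expr0n.
Qed.

Lemma enormN v : enorm (- v) = enorm v.
Proof. by rewrite /enorm; congr Num.sqrt; apply: eq_bigr => i _; rewrite mxE sqrrN. Qed.

Lemma coord_le_enorm v i : `|v ord0 i| <= enorm v.
Proof.
rewrite -sqrtr_sqr ler_sqrt; last by apply: sumr_ge0 => j _; exact: sqr_ge0.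
by rewrite (bigD1 i)//= lerDl sumr_ge0// => j _; exact: sqr_ge0.
Qed.

Lemma enorm_eq0_coord v i : enorm v = 0 -> v ord0 i = 0.
Proof.
by move=> v0; apply/eqP; rewrite -normr_le0 -v0; exact: coord_le_enorm.
Qed.

Lemma cauchy_schwarz u v :
  \sum_(i < n) u ord0 i * v ord0 i <= enorm u * enorm v.
Proof.
have [u0|u0] := eqVneq (enorm u) 0.
  by rewrite u0 mul0r big1// => i _; rewrite enorm_eq0_coord// mul0r.
have [v0|v0] := eqVneq (enorm v) 0.
  by rewrite v0 mulr0 big1// => i _; rewrite (enorm_eq0_coord _ v0) mulr0.
have up : 0 < enorm u by rewrite lt_def u0 enorm_ge0.
have vp : 0 < enorm v by rewrite lt_def v0 enorm_ge0.
(* AM-GM for the normalized vectors. *)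
have : \sum_(i < n) 2 * (u ord0 i / enorm u) * (v ord0 i / enorm v) <= 2.
  apply: (@le_trans _ _ (\sum_(i < n)
      ((u ord0 i / enorm u) ^+ 2 + (v ord0 i / enorm v) ^+ 2))).
    apply: ler_sum => i _; rewrite -subr_ge0.
    set a := _ / _; set b := _ / _.
    by rewrite (_ : _ - _ = (a - b) ^+ 2) ?sqr_ge0//; ring.
  rewrite big_split /=.
  under eq_bigr do rewrite expr_div_n.
  under [X in _ + X]eq_bigr do rewrite expr_div_n.
  rewrite -!mulr_suml -!enorm_sqr !divff ?expf_neq0//.
have E i : 2 * (u ord0 i / enorm u) * (v ord0 i / enorm v) =
    (u ord0 i * v ord0 i) * (2 / (enorm u * enorm v)) by field; rewrite u0 v0.
under eq_bigr do rewrite E.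
rewrite -mulr_suml mulrA ler_pdivrMr ?mulr_gt0// mulrC.
by rewrite ler_pM2l.
Qed.

Lemma enormD u v : enorm (u + v) <= enorm u + enorm v.
Proof.
rewrite -(@ler_pXn2r _ 2%N)// ?nnegrE ?addr_ge0 ?enorm_ge0//.
rewrite enorm_sqr.
under eq_bigr do rewrite mxE sqrrD.
rewrite !big_split/= -!enorm_sqr sqrrD lerD2r lerD2l -mulr2n ler_pMn2r//.
exact: cauchy_schwarz.
Qed.

Lemma enorm_le_norm v : enorm v <= n%:R * `|v|.
Proof.
have vi i : `|v ord0 i| <= `|v|.
  by rewrite [leRHS]/Num.norm/= mx_normrE; apply/bigmax_geP; right; exists (ord0, i).
apply: (@le_trans _ _ (\sum_(i < n) `|v ord0 i|)).
  rewrite -(@ler_pXn2r _ 2%N)// ?nnegrE ?enorm_ge0 ?sumr_ge0//.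
  rewrite enorm_sqr.
  (* Nonnegativity of the partial sum is carried along, since the cross term of its square must be
     nonnegative. *)
  suff: 0 <= \sum_(i < n) `|v ord0 i| /\
      \sum_(i < n) v ord0 i ^+ 2 <= (\sum_(i < n) `|v ord0 i|) ^+ 2 by case.
  apply: (big_rec2 (fun a b : R => 0 <= a /\ b <= a ^+ 2)) => [|i a b _ [a0 ba]].
    by rewrite expr0n.
  split; first by rewrite addr_ge0.
  have : 0 <= `|v ord0 i| * a by rewrite mulr_ge0.
  by rewrite sqrrD real_normK ?num_real//; lra.
apply: le_trans (ler_sum _ (fun i _ => vi i)) _.
by rewrite sumr_const card_ord mulr_natl.
Qed.

End euclidean_norm.

Section geometry.
Context {R : realType} {n : nat} {E : set 'rV[R]_n} {E0 : E !=set0}.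
Local Notation S := (borel_subspace E0).
Implicit Types x y z : S.

Lemma pdist_ge0 x y : 0 <= pdist x y. Proof. exact: enorm_ge0. Qed.

Lemma pnorm_ge0 x : 0 <= pnorm x. Proof. exact: enorm_ge0. Qed.

Lemma pdistxx x : pdist x x = 0.
Proof. by rewrite /pdist subrr enorm0. Qed.

Lemma pdistC x y : pdist x y = pdist y x.
Proof. by rewrite /pdist -enormN opprB. Qed.

Lemma pdist_triangle y x z : pdist x z <= pdist x y + pdist y z.
Proof.
rewrite /pdist (_ : _ - _ = (set_val x - set_val y) + (set_val y - set_val z)).
  exact: enormD.
by rewrite addrA subrK.
Qed.

Lemma pnorm_le x y : pnorm x <= pnorm y + pdist x y.
Proof.
rewrite /pnorm -[X in enorm X <= _](subrK (set_val y)) addrC.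
exact: enormD.
Qed.

Lemma pdist_le_pnorm x y : pdist x y <= pnorm x + pnorm y.
Proof. by rewrite /pdist (le_trans (enormD _ _))// enormN. Qed.

Lemma pdist_lip x y z : `|pdist x z - pdist y z| <= pdist x y.
Proof.
have := pdist_triangle y x z; have := pdist_triangle x y z.
by rewrite (pdistC y x) ler_norml => ? ?; lra.
Qed.

(** The topology of [S] comes from the sup norm. Together with [open_pdist] this shows that its open
    sets are those of the Euclidean distance. *)
Lemma pdist_open (U : set S) :
  (forall x, U x -> exists2 e : R, 0 < e & forall y, pdist x y < e -> U y) ->
  open U.
Proof.
move=> HU; rewrite openE => x /HU[e e0 eU].
(* n + 1 rather than the factor n of [enorm_le_norm], to have a positive number also for n = 0. *)
pose k : R := n.+1%:R.
have k0 : 0 < k by rewrite ltr0n.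
rewrite /interior/= nbhsE/=.
exists ((fun y : S => set_val y) @^-1` ball (set_val x) (e / k)).
  split; last exact/ballxx/divr_gt0.
  exists (ball (set_val x) (e / k)) => //.
  exact: ball_open.
move=> y; rewrite /= mx_norm_ball /ball_/= => xy; apply: eU.
apply: le_lt_trans (enorm_le_norm _) _.
apply: (@le_lt_trans _ _ (k * `|set_val x - set_val y|)).
  by rewrite ler_wpM2r// ler_nat.
by rewrite mulrC -ltr_pdivlMr.
Qed.

Lemma open_pdist (U : set S) x : open U -> U x ->
  exists2 e : R, 0 < e & forall y, pdist x y < e -> U y.
Proof.
move=> [V oV <-] /= Vx.
have /nbhs_ballP[e /= e0 eV] := open_nbhs_nbhs (conj oV Vx).
exists e => // y xy; apply: eV; split => // i j.
rewrite (ord1 i) /ball/= ; apply: le_lt_trans xy.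
rewrite -[X in `|X|](_ : (set_val x - set_val y) ord0 j = _); last by rewrite !mxE.
exact: coord_le_enorm.
Qed.

End geometry.

Section separability.
Context {R : realType} {n : nat} {E : set 'rV[R]_n} (E0 : E !=set0).
Local Notation S := (borel_subspace E0).

(* Each ball of rational centre and radius 1/k contributes one of its points
   in E, if it has any. *)
Lemma exists_dense_seq : exists s : nat -> S,
  forall x (e : R), 0 < e -> exists i, pdist x (s i) < e.
Proof.
pose near (c : 'rV[rat]_n) (k : nat) : set S :=
  [set x : S | enorm (set_val x - map_mx ratr c) < k.+1%:R^-1].
pose s (i : nat) : S :=
  if unpickle i is Some (c, k) then get (near c k) else point.
exists s => x e e0.
(* The factor 2: both x and the point chosen by [s] lie within 1/(k+1) of the same rational
   centre. *)
have [k ke] : exists k : nat, 2 * k.+1%:R^-1 < e.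
  have := near_infty_natSinv_lt (PosNum (divr_gt0 e0 (ltr0n R 2))).
  case=> k _ /(_ k (leqnn k)) /= ke; exists k.
  by rewrite mulrC -ltr_pdivlMr.
pose e' : R := k.+1%:R^-1 / n.+1%:R.
have e'0 : 0 < e' by rewrite divr_gt0// invr_gt0.
have /choice[c cP] : forall i : 'I_n, exists c : rat, `|set_val x ord0 i - ratr c| < e'.
  move=> i.
  have [] := @dense_rat R (ball (set_val x ord0 i : R) e').
  - by exists (set_val x ord0 i); exact: ballxx.
  - exact: ball_open.
  - by move=> y [xy [c _ cy]]; exists c; rewrite cy.
pose C : 'rV[rat]_n := \row_i c i.
have xC : near C k x.
  rewrite /near/=; apply: le_lt_trans (enorm_le_norm _) _.
  apply: (@le_lt_trans _ _ (n%:R * e')).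
    rewrite ler_wpM2l// [leLHS]/Num.norm/= mx_normrE; apply/bigmax_leP; split.
      exact: ltW.
    by move=> [i j] _; rewrite (ord1 i) !mxE/= ltW.
  rewrite /e' mulrCA gtr_pMr ?invr_gt0//.
  by rewrite ltr_pdivrMr// mul1r ltr_nat.
exists (pickle (C, k)); rewrite /s pickleK.
have sC : near C k (get (near C k)) by apply: getPex; exists x.
rewrite /pdist; set y := get _.
rewrite (_ : _ - _ = (set_val x - map_mx ratr C) - (set_val y - map_mx ratr C)).
  apply: le_lt_trans (enormD _ _) _; rewrite enormN; apply: lt_trans ke.
  by rewrite mulr_natl mulr2n; exact: ltrD.
by rewrite opprB addrA subrK.
Qed.

Definition dense_seq : nat -> S := sval (cid exists_dense_seq).

Lemma dense_seqP x (e : R) : 0 < e -> exists i, pdist x (dense_seq i) < e.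
Proof. exact: (svalP (cid exists_dense_seq)). Qed.

End separability.

Lemma measurable_fun_gt d (T : measurableType d) (R : realType) (f : T -> R) :
  (forall c, measurable [set t | c < f t]) -> measurable_fun setT f.
Proof.
move=> mf _; apply: (measurability _ (measurable_realfun.RGenOInfty.measurableE R)) => //.
move=> _ [_ [c ->] <-]; rewrite setTI; have := mf c; congr measurable.
by apply/seteqP; split => t /=; rewrite in_itv/= andbT.
Qed.

Section lipschitz.
Context {R : realType}.

Definition lipschitz_fun {n} {E : set 'rV[R]_n} {E0 : E !=set0}
    (f : borel_subspace E0 -> R) (L : R) :=
  forall x y, `|f x - f y| <= L * pdist x y.

Section one_variable.
Context {n : nat} {E : set 'rV[R]_n} {E0 : E !=set0}.
Local Notation S := (borel_subspace E0).

Lemma pdist_open_measurable (U : set S) :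
  (forall x, U x -> exists2 e : R, 0 < e & forall y, pdist x y < e -> U y) ->
  measurable U.
Proof. by move=> /pdist_open oU; exact: sub_sigma_algebra. Qed.

Lemma lipschitz_measurable (f : S -> R) L :
  lipschitz_fun f L -> measurable_fun setT f.
Proof.
move=> fL; apply: measurable_fun_gt => c; apply: pdist_open_measurable => x /= cf.
(* The sign of L is arbitrary here, and L may vanish. *)
have L1 : 0 < `|L| + 1 by rewrite ltr_wpDl.
exists ((f x - c) / (`|L| + 1)); first by rewrite divr_gt0 ?subr_gt0.
move=> y; rewrite ltr_pdivlMr// => xy.
have := fL x y; rewrite ler_norml => /andP[_ h].
have : L * pdist x y <= pdist x y * (`|L| + 1).
  rewrite mulrC ler_wpM2l ?pdist_ge0//.
  by rewrite (le_trans (ler_norm L))// lerDl.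
by lra.
Qed.

Lemma pdistr_measurable z : measurable_fun setT (fun x : S => pdist x z).
Proof.
by apply: (@lipschitz_measurable _ 1) => x y; rewrite mul1r; exact: pdist_lip.
Qed.

Lemma pnorm_lipschitz : lipschitz_fun (@pnorm R n E E0) 1.
Proof.
move=> x y; rewrite mul1r ler_norml.
have := pnorm_le x y; have := pnorm_le y x; rewrite (pdistC y x) => ? ?.
by apply/andP; split; lra.
Qed.

Lemma pnorm_measurable : measurable_fun setT (@pnorm R n E E0).
Proof. exact: lipschitz_measurable pnorm_lipschitz. Qed.

End one_variable.

Section three_variables.
Context {n1 n2 n3 : nat} {E1 : set 'rV[R]_n1} {E2 : set 'rV[R]_n2}
  {E3 : set 'rV[R]_n3} {E10 : E1 !=set0} {E20 : E2 !=set0} {E30 : E3 !=set0}.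
Local Notation S1 := (borel_subspace E10).
Local Notation S2 := (borel_subspace E20).
Local Notation S3 := (borel_subspace E30).

(* By separability, g is a countable supremum of the functions
   g s - L * (distance to s). *)
Lemma lipschitz3_measurable d (T : measurableType d) (g : S1 -> S2 -> S3 -> R) L
    (f1 : T -> S1) (f2 : T -> S2) (f3 : T -> S3) : 0 <= L ->
  (forall x a y x' a' y', `|g x a y - g x' a' y'| <=
     L * (pdist x x' + pdist a a' + pdist y y')) ->
  measurable_fun setT f1 -> measurable_fun setT f2 -> measurable_fun setT f3 ->
  measurable_fun setT (fun t => g (f1 t) (f2 t) (f3 t)).
Proof.
move=> L0 gL mf1 mf2 mf3; apply: measurable_fun_gt => c.
pose s1 := dense_seq E10; pose s2 := dense_seq E20; pose s3 := dense_seq E30.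
pose h i j k t := g (s1 i) (s2 j) (s3 k) - L * (pdist (f1 t) (s1 i) +
  pdist (f2 t) (s2 j) + pdist (f3 t) (s3 k)).
have mh i j k : measurable [set t | c < h i j k t].
  have : measurable_fun setT (h i j k).
    apply: measurable_funB => //; apply: measurable_funM => //.
    by apply: measurable_funD; first apply: measurable_funD;
      apply: (measurableT_comp (pdistr_measurable _)).
  move=> /(_ measurableT _ (measurable_itv `]c, +oo[)); rewrite setTI.
  by congr measurable; apply/seteqP; split => t /=; rewrite in_itv/= andbT.
rewrite (_ : [set _ | _] =
    \bigcup_i \bigcup_j \bigcup_k [set t | c < h i j k t]).
  by apply: bigcupT_measurable => i; apply: bigcupT_measurable => j;
    apply: bigcupT_measurable => k; exact: mh.
apply/seteqP; split => [t /= cg|t [i _ [j _ [k _ /= ch]]]]; last first.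
  have := gL (f1 t) (f2 t) (f3 t) (s1 i) (s2 j) (s3 k).
  by move: ch; rewrite /h ler_norml => ? /andP[? _]; lra.
(* The three distances add up to at most 3 e. The Lipschitz error and the penalty in [h] then each
   cost at most a third of g - c, so [h] stays above c. *)
pose e := (g (f1 t) (f2 t) (f3 t) - c) / (9 * (L + 1)).
have L1 : 0 < L + 1 by lra.
have e0 : 0 < e by rewrite divr_gt0 ?subr_gt0// mulr_gt0.
have [i ie] := dense_seqP (f1 t) e0.
have [j je] := dense_seqP (f2 t) e0.
have [k ke] := dense_seqP (f3 t) e0.
exists i => //; exists j => //; exists k => //=; rewrite /h.
have := gL (f1 t) (f2 t) (f3 t) (s1 i) (s2 j) (s3 k).
set D := _ + pdist _ (s3 k).
have De : D <= 3 * e by rewrite /D /s1 /s2 /s3; lra.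
have : L * D <= L * (3 * e) by rewrite ler_wpM2l.
have : L * (3 * e) <= (L + 1) * (3 * e) by rewrite ler_wpM2r//; lra.
have : (L + 1) * (3 * e) = (g (f1 t) (f2 t) (f3 t) - c) / 3.
  by rewrite /e; field; rewrite gt_eqF.
by rewrite ler_norml => -> ? ? /andP[_ ?]; lra.
Qed.

End three_variables.
End lipschitz.

Lemma compact_pdist_bounded (R : realType) n (A : set 'rV[R]_n) (A0 : A !=set0) :
  compact A -> exists M : R, forall a b : borel_subspace A0, pdist a b <= M.
Proof.
move=> /compact_bounded[M [_ /(_ (M + 1))]]; rewrite ltrDl ltr01 => /(_ isT) AM.
have le_M (a : borel_subspace A0) : pnorm a <= n%:R * (M + 1).
  rewrite /pnorm; apply: le_trans (enorm_le_norm _) _.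
  by rewrite ler_wpM2l//; apply: AM; exact: set_valP.
exists (n%:R * (M + 1) + n%:R * (M + 1)) => a b.
by rewrite (le_trans (pdist_le_pnorm _ _))// lerD.
Qed.

(** * Wasserstein distance and integrals of Lipschitz functions *)

Section law_transfer.
Context d d' (T : measurableType d) (T' : measurableType d') (R : realType).
Context (mu : {measure set T -> \bar R}) (nu : {measure set T' -> \bar R}).
Context (phi : T -> T') (mphi : measurable_fun setT phi).
Hypothesis law : forall B, measurable B -> mu (phi @^-1` B) = nu B.

(** Change of variables for a [nu] that agrees with the image measure on measurable sets only. It
    serves for marginals of couplings, redrawn and stopped paths. *)
Lemma ge0_integral_law (f : T' -> \bar R) : measurable_fun setT f ->
  (forall y, 0 <= f y)%E -> (\int[mu]_x f (phi x) = \int[nu]_y f y)%E.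
Proof.
move=> mf f0; have -> : (\int[nu]_y f y = \int[pushforward mu phi]_y f y)%E.
  by apply: eq_measure_integral => B mB _; rewrite -law.
by rewrite ge0_integral_pushforward// preimage_setT.
Qed.

Lemma integral_law (f : T' -> \bar R) : measurable_fun setT f ->
  (\int[mu]_x f (phi x) = \int[nu]_y f y)%E.
Proof.
move=> mf; change (\int[mu]_x (f \o phi) x = \int[nu]_y f y)%E.
rewrite integralE [RHS]integralE funepos_comp funeneg_comp.
rewrite -(ge0_integral_law (measurable_funepos mf)); last exact: funepos_ge0.
rewrite -(ge0_integral_law (measurable_funeneg mf)); last exact: funeneg_ge0.
by [].
Qed.

Lemma integrable_law (f : T' -> \bar R) :
  nu.-integrable setT f -> mu.-integrable setT (f \o phi).
Proof.
move=> /integrableP[mf fi]; apply/integrableP; split.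
  exact: measurableT_comp.
rewrite (ge0_integral_law (f := fun y => `|f y|%E))//.
exact: measurableT_comp.
Qed.

Lemma Rintegral_law (f : T' -> R) : measurable_fun setT f ->
  \int[mu]_x f (phi x) = \int[nu]_y f y.
Proof.
by move=> mf; rewrite /Rintegral (integral_law (f := EFin \o f))//; exact/measurable_EFinP.
Qed.

End law_transfer.

Lemma bernoulli (R : realDomainType) (k : nat) (y : R) :
  -1 <= y -> 1 + k%:R * y <= (1 + y) ^+ k.
Proof.
move=> y1; elim: k => [|k IH]; first by rewrite mul0r addr0 expr0.
have h : (1 + y) * (1 + k%:R * y) <= (1 + y) * (1 + y) ^+ k.
  by rewrite ler_wpM2l//; lra.
rewrite exprS; apply: le_trans h.
have : 0 <= k%:R * y ^+ 2 by rewrite mulr_ge0// sqr_ge0.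
by rewrite -natr1; lra.
Qed.

Section wasserstein.
Context {R : realType} {n : nat} {E : set 'rV[R]_n} {E0 : E !=set0}.
Local Notation S := (borel_subspace E0).
Implicit Types P Q : probability S R.

Lemma pdist_measurable : measurable_fun setT (fun z : S * S => pdist z.1 z.2).
Proof.
(* The middle variable is a dummy, fed with [fst]. *)
apply: (@lipschitz3_measurable R n n n E E E E0 E0 E0 _ _ (fun x _ y => pdist x y) 1
  fst fst snd) => // x a y x' a' y'.
rewrite mul1r; have := pdist_lip x x' y; have := pdist_lip y y' x'.
rewrite !(pdistC _ x') => h1 h2.
have := ler_normD (pdist x y - pdist x' y) (pdist x' y - pdist x' y').
rewrite addrA subrK => /le_trans; apply.
by have := pdist_ge0 a a'; lra.
Qed.

(** This is W_1 <= W_q at the level of a single coupling. A coupling with q-th moment below w^q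
    exists by definition of the infimum. The tangent of d^q at d = w, solved for d, gives d <= c + k
    d^q, and c + k w^q = w. *)
Lemma coupling_lt_wass (q : nat) P Q (w : R) : (0 < q)%N -> 0 < w ->
  (wass q P Q < w%:E)%E ->
  exists2 pi, coupling P Q pi & (\int[pi]_z (pdist z.1 z.2)%:E <= w%:E)%E.
Proof.
move=> q0 w0; rewrite /wass; set I := ereal_inf _ => Iw.
have I0 : (0 <= I)%E.
  apply/ereal_infP => _ [pi _ <-]; apply: integral_ge0 => z _.
  by rewrite lee_fin exprn_ge0// pdist_ge0.
have wE : w%:E = ((w ^+ q)%:E `^ (q%:R^-1))%E.
  rewrite poweR_EFin -powR_mulrn ?ltW// -powRrM divff ?powRr1 ?ltW//.
  by rewrite pnatr_eq0 -lt0n.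
have {Iw} : (I < (w ^+ q)%:E)%E.
  rewrite ltNge; apply/negP => wI; move: Iw; rewrite ltNge => /negP; apply.
  rewrite wE; apply: gt0_ler_poweR => //; rewrite ?invr_ge0// in_itv/=.
    by rewrite leey lee_fin exprn_ge0// ltW.
  by rewrite leey I0.
move=> /ereal_inf_lt[_ [pi cpi <-] piw]; exists pi => //.
have q0' : 0 < q%:R :> R by rewrite ltr0n.
pose k := (q%:R * w ^+ q.-1)^-1.
have k0 : 0 < k by rewrite invr_gt0 mulr_gt0// exprn_gt0.
pose c := w * (1 - q%:R^-1).
have c0 : 0 <= c.
  by rewrite mulr_ge0 ?(ltW w0)// subr_ge0 invf_le1// ler1n.
have wkq : k * w ^+ q = w / q%:R.
  have -> : w ^+ q = w * w ^+ q.-1 by rewrite -exprS prednK.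
  by rewrite /k; field; rewrite expf_neq0 !gt_eqF.
(* Bernoulli's inequality for (d / w)^q. *)
have le z : pdist z.1 z.2 <= c + k * pdist z.1 z.2 ^+ q :> R.
  set a := pdist _ _; have a0 : 0 <= a by exact: pdist_ge0.
  have aw0 : -1 <= a / w - 1 by rewrite lerBrDl addrN divr_ge0// ltW.
  have := bernoulli q aw0; rewrite (addrC 1 (_ - 1)) subrK expr_div_n => h.
  have -> : k * a ^+ q = w / q%:R * (a ^+ q / w ^+ q).
    by rewrite -wkq; field; rewrite expf_neq0 ?gt_eqF.
  have : w / q%:R * (1 + q%:R * (a / w - 1)) <= w / q%:R * (a ^+ q / w ^+ q).
    by rewrite ler_wpM2l// divr_ge0 ?ltW.
  have -> : w / q%:R * (1 + q%:R * (a / w - 1)) = w / q%:R + a - w.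
    by field; rewrite !gt_eqF.
  by rewrite /c mulrBr mulr1; lra.
have md := pdist_measurable.
apply: (@le_trans _ _ (\int[pi]_z (c%:E + k%:E * (pdist z.1 z.2 ^+ q)%:E))%E).
  apply: ge0_le_integral => //.
  - by move=> z _; rewrite lee_fin pdist_ge0.
  - exact/measurable_EFinP.
  - under eq_fun do rewrite -EFinM -EFinD.
    apply/measurable_EFinP; apply: measurable_funD => //.
    by apply: measurable_funM => //; exact: measurable_funX.
  - by move=> z _; rewrite -EFinM -EFinD lee_fin.
have mdq : measurable_fun setT (fun z : S * S => (pdist z.1 z.2 ^+ q)%:E).
  by apply/measurable_EFinP; exact: measurable_funX.
have dq0 (z : S * S) : (0 <= (pdist z.1 z.2 ^+ q)%:E)%E.
  by rewrite lee_fin exprn_ge0// pdist_ge0.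
rewrite ge0_integralD//; last 2 first.
- by move=> z _; rewrite mule_ge0// lee_fin ltW.
- exact: measurable_funeM.
rewrite integral_cst//= probability_setT mule1 ge0_integralZl//; last by rewrite lee_fin ltW.
apply: (@le_trans _ _ (c%:E + k%:E * (w ^+ q)%:E)%E).
  by rewrite leeD2l// lee_wpmul2l ?lee_fin ?ltW// ltW.
by rewrite -EFinM -EFinD wkq lee_fin /c mulrBr mulr1 subrK.
Qed.

Lemma wass1_le (q : nat) P Q (w : R) : (0 < q)%N -> 0 < w ->
  (wass q P Q < w%:E)%E -> (wass 1 P Q <= w%:E)%E.
Proof.
move=> q0 w0 /(coupling_lt_wass q0 w0)[pi cpi piw].
rewrite /wass invr1 poweRe1; last first.
  apply/ereal_infP => _ [pi' _ <-]; apply: integral_ge0 => z _.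
  by rewrite lee_fin exprn_ge0// pdist_ge0.
by apply: le_trans piw; apply: ereal_inf_lbound; exists pi.
Qed.

Lemma finite_moment_le (q : nat) P : (0 < q)%N ->
  finite_moment E0 q P -> finite_moment E0 1 P.
Proof.
move=> q0; rewrite /finite_moment/= => Pq.
have mq : measurable_fun setT (fun x : S => (pnorm x ^+ q)%:E).
  by apply/measurable_EFinP; apply: measurable_funX; exact: pnorm_measurable.
have q0' (x : S) : (0 <= (pnorm x ^+ q)%:E)%E.
  by rewrite lee_fin exprn_ge0// pnorm_ge0.
apply: (@le_lt_trans _ _ (\int[P]_x (1%:E + (pnorm x ^+ q)%:E))%E).
  apply: ge0_le_integral => //.
  - by move=> x _; rewrite lee_fin expr1 pnorm_ge0.
  - by apply/measurable_EFinP; apply: measurable_funX; exact: pnorm_measurable.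
  - by apply: emeasurable_funD.
  - move=> x _; rewrite -EFinD lee_fin expr1.
    have [x1|x1] := leP (pnorm x) 1; first by rewrite (le_trans x1)// lerDl -lee_fin.
    by rewrite (@le_trans _ _ (pnorm x ^+ q))// ?lerDr// ler_eXnr// ltW.
rewrite ge0_integralD// integral_cst//= probability_setT mule1.
by rewrite lte_add_pinfty// ltry.
Qed.

Lemma pnorm_integrable P : finite_moment E0 1 P ->
  P.-integrable setT (EFin \o @pnorm R n E E0).
Proof.
move=> P1; apply/integrableP; split.
  by apply/measurable_EFinP; exact: pnorm_measurable.
under eq_integral do rewrite /= ger0_norm ?pnorm_ge0//.
exact: P1.
Qed.

Lemma cst_integrable d (T : measurableType d) (P : probability T R) (c : R) :
  P.-integrable setT (EFin \o cst c).
Proof.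
by apply: finite_measure_integrable_cst.
Qed.

Lemma growth_integrable P (f : S -> R) (a b : R) : finite_moment E0 1 P ->
  measurable_fun setT f -> (forall x, `|f x| <= a + b * pnorm x) ->
  P.-integrable setT (EFin \o f).
Proof.
move=> P1 mf fab; apply: (@le_integrable _ _ _ _ _ _ _
  (EFin \o (fun x => a + b * pnorm x))) => //.
- exact/measurable_EFinP.
- move=> x _ /=; rewrite lee_fin; apply: le_trans (fab x) _; exact: ler_norm.
- rewrite (_ : _ \o _ = (EFin \o cst a) \+ (cst b%:E \* (EFin \o @pnorm R n E E0)))%E//.
  apply: integrableD => //; first exact: cst_integrable.
  by apply: integrableZl => //; exact: pnorm_integrable.
Qed.

Lemma lipschitz_integrable P (f : S -> R) L : finite_moment E0 1 P ->
  0 <= L -> lipschitz_fun f L -> P.-integrable setT (EFin \o f).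
Proof.
move=> P1 L0 fL; apply: (@growth_integrable _ _ (`|f point| + L * pnorm (point : S)) L) => //.
  exact: lipschitz_measurable fL.
move=> x; have := fL x point; have := ler_normD (f x - f point) (f point).
rewrite subrK.
have : L * pdist x point <= L * (pnorm x + pnorm (point : S)).
  by rewrite ler_wpM2l// pdist_le_pnorm.
by lra.
Qed.

(* The easy half of Kantorovich duality. *)
Lemma Rintegral_le_wass (q : nat) P Q (f : S -> R) L w : (0 < q)%N ->
  finite_moment E0 1 P -> finite_moment E0 1 Q ->
  0 <= L -> 0 <= w -> lipschitz_fun f L -> (wass q P Q <= w%:E)%E ->
  `|\int[P]_x f x - \int[Q]_x f x| <= L * w.
Proof.
move=> q0 P1 Q1 L0 w0 fL PQw; apply/ler_addgt0Pr => e e0.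
(* A coupling is available only for radii strictly above the distance. The excess e' costs L e' <=
   e, also for L = 0. *)
pose e' := e / (L + 1); have L1 : 0 < L + 1 by lra.
have e'0 : 0 < e' by rewrite divr_gt0.
have Lw : L * (w + e') <= L * w + e.
  by rewrite mulrDr lerD2l /e' mulrCA ger_pMr// ler_pdivrMr//; lra.
apply: le_trans Lw.
have we0 : 0 < w + e' by lra.
have [|pi cpi piw] := @coupling_lt_wass q P Q (w + e') q0 we0.
  by apply: le_lt_trans PQw _; rewrite lte_fin ltrDl.
have mf := lipschitz_measurable fL.
have l1 B : measurable B -> pi (fst @^-1` B) = P B.
  by move=> mB; have [<- _] := cpi B mB; congr (pi _); apply/seteqP; split => -[x y] //= [].
have l2 B : measurable B -> pi (snd @^-1` B) = Q B.
  by move=> mB; have [_ <-] := cpi B mB; congr (pi _); apply/seteqP; split => -[x y] //= [].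
have i1 := integrable_law measurable_fst l1 (lipschitz_integrable P1 L0 fL).
have i2 := integrable_law measurable_snd l2 (lipschitz_integrable Q1 L0 fL).
rewrite -(Rintegral_law measurable_fst l1)// -(Rintegral_law measurable_snd l2)//.
rewrite -RintegralB//.
have ib : pi.-integrable setT (EFin \o (fun z : S * S => f z.1 - f z.2)).
  exact: (integrableB measurableT i1 i2).
apply: le_trans (le_normr_Rintegral _ ib) _ => //.
have md := pdist_measurable.
have id : pi.-integrable setT (EFin \o (fun z : S * S => pdist z.1 z.2)).
  apply/integrableP; split; first exact/measurable_EFinP.
  under eq_integral do rewrite /= ger0_norm ?pdist_ge0//.
  by apply: le_lt_trans piw _; rewrite ltry.
apply: (@le_trans _ _ (\int[pi]_z (L * pdist z.1 z.2))).
  apply: le_Rintegral => //.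
  - exact: integrable_norm ib.
  - exact: (integrableZl _ L id).
rewrite RintegralZl// ler_wpM2l// -lee_fin /Rintegral fineK//.
exact: integrable_fin_num.
Qed.

End wasserstein.

(** * Trajectories and iterated integrals *)

Section trajectories.
Context {R : realType} {n : nat} {E : set 'rV[R]_n} {E0 : E !=set0}.
Local Notation S := (borel_subspace E0).
Local Notation Omega := (trajectory E0).

Lemma coord_measurable t : measurable_fun setT (fun w : Omega => w t).
Proof.
move=> _ B mB; rewrite setTI; apply: sub_sigma_algebra.
by exists t => //; exists B.
Qed.

Lemma trajectory_measurable d (T : measurableType d) (f : T -> Omega) :
  (forall t, measurable_fun setT (fun z => f z t)) -> measurable_fun setT f.
Proof.
move=> mf; apply: (@measurability _ _ T Omega setT f
  [set ((fun w : nat -> S => w t) @^-1` B) | t in [set: nat] & B in measurable]).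
  by [].
by move=> _ [_ [t _ [B mB <-]] <-]; exact: mf.
Qed.

Definition update (s : nat) (w : Omega) (y : S) : Omega := [eta w with s |-> y].

Lemma updateE s w y t : update s w y t = if t == s then y else w t.
Proof. by []. Qed.

Lemma update_measurable s :
  measurable_fun setT (fun z : Omega * S => update s z.1 z.2).
Proof.
apply: trajectory_measurable => t; rewrite /update/=.
case: (t == s); first exact: measurable_snd.
by apply: (measurableT_comp (coord_measurable t)); exact: measurable_fst.
Qed.

Lemma update_section_measurable s (w : Omega) : measurable_fun setT (update s w).
Proof.
apply: trajectory_measurable => t; rewrite /update/=.
by case: (t == s); [exact: measurable_id|exact: measurable_cst].
Qed.

(** With [V] = [Prop] this applies to events, as sets are functions to [Prop]. *)
Definition depends_upto {V : Type} (k : nat) (f : Omega -> V) :=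
  forall w w' : Omega, (forall i, (i <= k)%N -> w i = w' i) -> f w = f w'.

Lemma depends_upto_le {V : Type} j k (f : Omega -> V) :
  (j <= k)%N -> depends_upto j f -> depends_upto k f.
Proof. by move=> jk fj w w' ww'; apply: fj => i ij; apply: ww'; exact: leq_trans jk. Qed.

End trajectories.

Definition measurable_kernels {R : realType} {n : nat} {E : set 'rV[R]_n}
    {E0 : E !=set0} (K : nat -> borel_subspace E0 -> probability (borel_subspace E0) R) :=
  forall t B, measurable B -> measurable_fun setT (fun y => K t y B).

Section current_state_kernel.
Context {R : realType} {n : nat} {E : set 'rV[R]_n} {E0 : E !=set0}.
Local Notation S := (borel_subspace E0).
Local Notation Omega := (trajectory E0).
Context (K : nat -> S -> probability S R).

(** [K s] as a kernel on paths, through the state at time s. The argument [mK] lets the kernel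
    instances below, which are built from it, be found by unification. *)
Definition current_kernel (mK : measurable_kernels K) s (w : Omega) :
  {measure set S -> \bar R} := K s (w s).

Hypothesis mK : measurable_kernels K.

Let measurable_current s U : measurable U ->
  measurable_fun setT (current_kernel mK s ^~ U).
Proof.
by move=> mU; apply: (measurableT_comp (mK s mU)); exact: coord_measurable.
Qed.

HB.instance Definition _ s :=
  isKernel.Build _ _ _ _ R (current_kernel mK s) (measurable_current s).

Let current_prob s w : current_kernel mK s w setT = 1%E.
Proof. by rewrite /current_kernel/= probability_setT. Qed.

HB.instance Definition _ s :=
  Kernel_isProbability.Build _ _ _ _ R (current_kernel mK s) (current_prob s).

Lemma measurable_integral_kernel s (g : Omega * S -> \bar R) :
  (forall z, 0 <= g z)%E -> measurable_fun setT g ->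
  measurable_fun setT (fun w : Omega => \int[K s (w s)]_y g (w, y))%E.
Proof.
exact: (measurable_fun_integral_finite_kernel g (current_kernel mK s)).
Qed.

End current_state_kernel.

Section iterated_integral.
Context {R : realType} {n : nat} {E : set 'rV[R]_n} {E0 : E !=set0}.
Local Notation S := (borel_subspace E0).
Local Notation Omega := (trajectory E0).
Context (K : nat -> S -> probability S R) (mK : measurable_kernels K).
Implicit Types f g : Omega -> \bar R.
Local Notation J := (iterated_integral K).

Lemma iterated_integralS s k f w :
  J s k.+1 f w = (\int[K s (w s)]_y J s.+1 k f (update s.+1 w y))%E.
Proof. by []. Qed.

Lemma iterated_integral_ge0 s k f w : (forall w, 0 <= f w)%E -> (0 <= J s k f w)%E.
Proof.
move=> f0; elim: k s w => [|k IH] s w //=.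
by apply: integral_ge0 => y _; exact: IH.
Qed.

Lemma iterated_integral_measurable s k f : measurable_fun setT f ->
  (forall w, 0 <= f w)%E -> measurable_fun setT (J s k f).
Proof.
move=> mf f0; elim: k s => [|k IH] s //=.
apply: (@measurable_integral_kernel _ _ _ _ _ mK s
  (fun z => J s.+1 k f (update s.+1 z.1 z.2))).
  by move=> z; exact: iterated_integral_ge0.
by apply: (measurableT_comp (IH _)); exact: update_measurable.
Qed.

Lemma measurable_update_section s (w : Omega) f :
  measurable_fun setT f -> measurable_fun setT (fun y => f (update s w y)).
Proof.
by move=> mf; apply: (measurableT_comp mf); exact: update_section_measurable.
Qed.

Lemma iterated_integral_section_measurable s k f w : measurable_fun setT f ->
  (forall w, 0 <= f w)%E ->
  measurable_fun setT (fun y => J s.+1 k f (update s.+1 w y)).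
Proof.
move=> mf f0; apply: measurable_update_section.
exact: iterated_integral_measurable.
Qed.

Lemma iterated_integralD s k f g w :
  measurable_fun setT f -> (forall w, 0 <= f w)%E ->
  measurable_fun setT g -> (forall w, 0 <= g w)%E ->
  J s k (fun w => f w + g w)%E w = (J s k f w + J s k g w)%E.
Proof.
move=> mf f0 mg g0; elim: k s w => [|k IH] s w //.
rewrite !iterated_integralS -ge0_integralD//.
- by apply: eq_integral => y _; rewrite IH.
- by move=> y _; exact: iterated_integral_ge0.
- exact: iterated_integral_section_measurable.
- by move=> y _; exact: iterated_integral_ge0.
- exact: iterated_integral_section_measurable.
Qed.

Lemma le_iterated_integral s k f g w :
  measurable_fun setT f -> (forall w, 0 <= f w)%E ->
  measurable_fun setT g -> (forall w, f w <= g w)%E ->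
  (J s k f w <= J s k g w)%E.
Proof.
move=> mf f0 mg fg; have g0 w' : (0 <= g w')%E by exact: le_trans (fg w').
elim: k s w => [|k IH] s w //.
rewrite !iterated_integralS; apply: ge0_le_integral => //.
- by move=> y _; exact: iterated_integral_ge0.
- exact: iterated_integral_section_measurable.
- exact: iterated_integral_section_measurable.
Qed.

Lemma iterated_integral_comp s j k f w :
  J s (j + k) f w = J s j (J (s + j) k f) w.
Proof.
elim: j s w => [|j IH] s w; first by rewrite add0n addn0.
rewrite addSn !iterated_integralS; apply: eq_integral => y _.
by rewrite IH addSnnS.
Qed.

Lemma iterated_integral_past s k f w : depends_upto s f -> J s k f w = f w.
Proof.
elim: k s w => [|k IH] s w fs //.
rewrite iterated_integralS.
transitivity (\int[K s (w s)]_y f w)%E.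
  apply: eq_integral => y _; rewrite IH; last exact: depends_upto_le fs.
  by apply: fs => i /leq_trans/(_ (leqnn _)) is'; rewrite updateE ltn_eqF.
by rewrite integral_cst//= probability_setT mule1.
Qed.

(** Coordinates beyond s + j are drawn from probability measures and leave f unchanged. This makes
    the measure of a cylinder independent of the horizon. *)
Lemma iterated_integral_stable s j k f w : depends_upto (s + j) f ->
  J s (j + k) f w = J s j f w.
Proof.
move=> fj; rewrite iterated_integral_comp; congr (J s j _ w).
by apply/funext => w'; rewrite iterated_integral_past.
Qed.

End iterated_integral.

(** * The Ionescu-Tulcea theorem *)

Definition cylinder {R : realType} {n : nat} {E : set 'rV[R]_n} {E0 : E !=set0}
    (B : set (trajectory E0)) :=
  measurable B /\ exists k, depends_upto k B.

Section cylinders.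
Context {R : realType} {n : nat} {E : set 'rV[R]_n} (E0 : E !=set0).
Local Notation Omega := (trajectory E0).
Implicit Types B : set Omega.

(** An alias: on [Omega] itself the measurable sets are those of the product sigma-algebra, here
    they are the algebra of cylinders. *)
Definition cylinder_space : Type := Omega.

HB.instance Definition _ := Pointed.on cylinder_space.

Let cylinder0 : cylinder (set0 : set Omega).
Proof. by split => //; exists 0%N. Qed.

Lemma depends_uptoC k B : depends_upto k B -> depends_upto k (~` B).
Proof. by move=> kB w w' /kB; rewrite /setC/= => ->. Qed.

Lemma depends_uptoU j k A B : depends_upto j A -> depends_upto k B ->
  depends_upto (maxn j k) (A `|` B).
Proof.
move=> jA kB w w' ww'; rewrite /setU/= (jA w w'); last first.
  by move=> i ij; apply: ww'; rewrite leq_max ij.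
by rewrite (kB w w')// => i ik; apply: ww'; rewrite leq_max ik orbT.
Qed.

Let cylinderU : setU_closed (@cylinder R n E E0).
Proof.
move=> A B [mA [j jA]] [mB [k kB]]; split; first exact: measurableU.
by exists (maxn j k); exact: depends_uptoU.
Qed.

Let cylinderC : setC_closed (@cylinder R n E E0).
Proof.
move=> B [mB [k kB]]; split; first exact: measurableC.
by exists k; exact: depends_uptoC.
Qed.

Definition cylinder_display : measure_display.
Proof. exact: default_measure_display. Qed.

HB.instance Definition _ := @isAlgebraOfSets.Build cylinder_display cylinder_space
  (@cylinder R n E E0) cylinder0 cylinderU cylinderC.

Lemma depends_upto_indic k B : depends_upto k B ->
  depends_upto k (fun w => (\1_B w)%:E : \bar R).
Proof.
move=> kB w w' ww'; rewrite !indicE; congr (nat_of_bool _)%:R%:E.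
by apply/idP/idP; rewrite !inE (kB _ _ ww').
Qed.

End cylinders.

Section ionescu_tulcea.
Context {R : realType} {n : nat} {E : set 'rV[R]_n} {E0 : E !=set0}.
Local Notation S := (borel_subspace E0).
Local Notation Omega := (trajectory E0).
Local Notation C := (cylinder_space E0).
Context (K : nat -> S -> probability S R).
Local Notation J := (iterated_integral K).
Local Notation ind B := (fun w => (\1_B w)%:E : \bar R).

Lemma indic_measurable (B : set Omega) : measurable B -> measurable_fun setT (ind B).
Proof. by move=> mB; apply/measurable_EFinP; exact: measurable_indic. Qed.

Lemma indic_ge0 (B : set Omega) w : (0 <= ind B w)%E.
Proof. by rewrite lee_fin indicE ler0n. Qed.

(** Some horizon for B, with default 0 if there is none. By [cylinder_measureE] every other horizon
    gives the same measure. *)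
Let depth (B : set Omega) : nat := xget 0%N [set k | depends_upto k B].

Let depthP (B : set C) : measurable B -> depends_upto (depth B) B.
Proof. by move=> [_ [k kB]]; apply: (@xgetPex _ 0%N [set k | depends_upto k B]); exists k. Qed.

Definition cylinder_measure (mK : measurable_kernels K) (x : S) (B : set C) : \bar R :=
  J 0 (depth B) (ind B) (cst x).

Hypothesis mK : measurable_kernels K.
Variable x : S.
Local Notation mu := (cylinder_measure mK x).

Lemma cylinder_measureE k (B : set C) : depends_upto k B ->
  mu B = J 0 k (ind B) (cst x).
Proof.
move=> kB.
have dB : depends_upto (depth B) B.
  by apply: (@xgetPex _ 0%N [set k | depends_upto k B]); exists k.
(* Both horizons are prolonged to their sum. *)
rewrite /cylinder_measure -(@iterated_integral_stable _ _ _ _ _ 0 (depth B) k).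
  rewrite addnC iterated_integral_stable// add0n; exact: depends_upto_indic.
by rewrite add0n; exact: depends_upto_indic.
Qed.

Let mu0 : mu set0 = 0%E.
Proof.
rewrite (@cylinder_measureE 0%N)//.
by rewrite /= indicE in_set0.
Qed.

Let mu_ge0 B : (0 <= mu B)%E.
Proof. exact/iterated_integral_ge0/indic_ge0. Qed.

Let muU (A B : set C) : measurable A -> measurable B -> [disjoint A & B] ->
  mu (A `|` B) = (mu A + mu B)%E.
Proof.
move=> mA mB /disj_setPS AB.
have dA := depthP mA; have dB := depthP mB.
have dAB := depends_uptoU dA dB.
set k := maxn _ _ in dAB.
have kA : depends_upto k A by apply: depends_upto_le dA; exact: leq_maxl.
have kB : depends_upto k B by apply: depends_upto_le dB; exact: leq_maxr.
rewrite !(cylinder_measureE dAB) (cylinder_measureE kA) (cylinder_measureE kB).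
rewrite -iterated_integralD//; last 2 first.
- by apply: indic_measurable; case: mA.
- by apply: indic_measurable; case: mB.
congr (J 0 k _ _); apply/funext => w; rewrite -EFinD; congr EFin.
rewrite !indicE in_setU.
have : ~~ ((w \in A) && (w \in B)).
  by apply/negP => /andP[]; rewrite !inE => wA wB; exact: (AB w).
by case: (w \in A); case: (w \in B) => //=; rewrite ?addr0 ?add0r.
Qed.

Let muT : mu setT = 1%E.
Proof. by rewrite (@cylinder_measureE 0%N)//= indicE in_setT. Qed.

Let mu_le (A B : set C) : measurable A -> measurable B -> A `<=` B -> (mu A <= mu B)%E.
Proof.
move=> mA mB AB; rewrite -(setDUK AB) muU//; first by rewrite leeDl.
  by apply: measurableD.
by apply/disj_setPS => w [Aw [_ nAw]]; exact: nAw.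
Qed.

Let mu_le1 (B : set C) : measurable B -> (mu B <= 1)%E.
Proof. by move=> mB; rewrite -muT; apply: mu_le => //; exact: measurableT. Qed.

Let sum_mu (F : (set C)^nat) k : (forall i, measurable (F i)) -> trivIset setT F ->
  (\sum_(0 <= i < k) mu (F i))%E = mu (\big[setU/set0]_(i < k) F i).
Proof.
move=> mF tF; elim: k => [|k IH]; first by rewrite big_geq// big_ord0 mu0.
rewrite big_nat_recr//= big_ord_recr/= IH muU//.
  by apply: bigsetU_measurable.
apply/disj_setPS => w [+ Fk].
rewrite -bigcup_mkord => -[i /= ik Fi].
have := tF i k Logic.I Logic.I (ex_intro _ w (conj Fi Fk)).
by move=> ik'; rewrite ik' ltnn in ik.
Qed.

(* M s i w is the conditional probability of B i given the path w up to time s.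
   It stays bounded away from 0 uniformly in i along a suitable path w*, and
   M s i w* is the indicator of B i once s exceeds the depth of B i. *)
Let shrinking_meet (B : (set C)^nat) (e : R) : (forall i, measurable (B i)) ->
  (forall i, B i.+1 `<=` B i) -> 0 < e -> (forall i, e%:E <= mu (B i))%E ->
  \bigcap_i B i !=set0.
Proof.
move=> mB dB e0 eB.
have mBO i : measurable (B i : set Omega) by case: (mB i).
pose c i := depth (B i).
have cB i : depends_upto (c i) (B i) by exact: depthP.
pose M s i w := J s (c i) (ind (B i)) w.
have ME s i k w : (c i <= s + k)%N -> J s k (ind (B i)) w = M s i w.
  move=> cik; rewrite /M -(@iterated_integral_stable _ _ _ _ _ s (c i) k).
    rewrite addnC iterated_integral_stable//.
    exact/depends_upto_indic/(depends_upto_le cik)/cB.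
  exact/depends_upto_indic/(depends_upto_le (leq_addl _ _))/cB.
have MS s i w : M s i w = (\int[K s (w s)]_y M s.+1 i (update s.+1 w y))%E.
  rewrite -(@ME s i (c i).+1) ?iterated_integralS//.
  by rewrite addnS -addSn leq_addl.
have M0 s i w : (0 <= M s i w)%E by exact/iterated_integral_ge0/indic_ge0.
have mM s i : measurable_fun setT (M s i).
  by apply: iterated_integral_measurable => //; exact: indic_measurable.
have Mle s i w : (M s i.+1 w <= M s i w)%E.
  rewrite -(@ME s i (c i + c i.+1)); last by rewrite addnCA leq_addr.
  rewrite -(@ME s i.+1 (c i + c i.+1)); last by rewrite addnA leq_addl.
  apply: le_iterated_integral => //; try exact: indic_measurable.
  move=> w'; rewrite lee_fin !indicE ler_nat leq_eqVlt.
  case: (boolP (w' \in B i.+1)) => [|_]; last by case: (_ \in _).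
  by rewrite inE => /dB; rewrite -in_setE => ->.
have M1 s i w : (M s i w <= 1)%E.
  apply: (@le_trans _ _ (J s (c i) (cst 1%E) w)).
    apply: le_iterated_integral => //; first exact: indic_measurable.
    by move=> w'; rewrite lee_fin indicE lern1 leq_b1.
  by rewrite iterated_integral_past.
have Mfin s i w : M s i w \is a fin_num.
  by rewrite ge0_fin_numE//; apply: le_lt_trans (M1 s i w) _; rewrite ltry.
pose P s w := exists2 a : R, 0 < a & forall i, (a%:E <= M s i w)%E.
(* If every y failed, the nonincreasing sequence M s.+1 i would tend to 0 for each y. By dominated
   convergence so would its integral M s i, against P s w. The premise stands under the quantifier
   so that [choice] applies to all pairs (s, w). *)
have Pnext s w : exists y, P s w -> P s.+1 (update s.+1 w y).
  apply: contrapT => /forallNP noy.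
  have Psw : P s w by apply: contrapT => nP; apply: (noy point).
  have {}noy y : ~ P s.+1 (update s.+1 w y) by move=> Py; apply: (noy y).
  have M_cvg y : (fun i => M s.+1 i (update s.+1 w y)) @ \oo --> 0%E.
    set u := fun i => _.
    have du : nonincreasing_seq u by apply/nonincreasing_seqP => i; exact: Mle.
    have := ereal_nonincreasing_cvgn du; set l := ereal_inf _ => ul.
    have l0 : (0 <= l)%E by apply/ereal_infP => _ [i _ <-]; exact: M0.
    have [<-//|l0'] := eqVneq l 0%E.
    have lp : (0 < l)%E by rewrite lt_def l0' l0.
    exfalso; apply: (noy y).
    have lfin : l \is a fin_num.
      rewrite ge0_fin_numE//; apply: (@le_lt_trans _ _ (u 0%N)).
        by apply: ereal_inf_lbound; exists 0%N.
      by apply: le_lt_trans (M1 _ _ _) _; rewrite ltry.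
    exists (fine l); first by rewrite -lte_fin fineK.
    by move=> i; rewrite fineK//; apply: ereal_inf_lbound; exists i.
  have [|||||_ _] := @dominated_convergence _ _ R (K s (w s)) setT measurableT
    (fun i y => M s.+1 i (update s.+1 w y)) (cst 0%E) (cst 1%E).
  - by move=> i; apply: measurable_update_section; exact: mM.
  - exact: measurable_cst.
  - by apply: aeW => y _; exact: M_cvg.
  - exact: cst_integrable.
  - by apply: aeW => y i _; rewrite gee0_abs.
  rewrite integral0 => cvgM; have [a a0 aM] := Psw.
  have : (a%:E <= 0)%E.
    rewrite -(cvg_lim _ cvgM)//; apply: lime_ge; first exact: cvgP cvgM.
    by apply: nearW => i; have := aM i; rewrite MS.
  by rewrite lee_fin leNgt a0.
have [Y PY] : exists Y : nat -> Omega -> S, forall s w, P s w -> P s.+1 (update s.+1 w (Y s w)).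
  have /choice[Y YP] : forall sw : nat * Omega, exists y,
      P sw.1 sw.2 -> P sw.1.+1 (update sw.1.+1 sw.2 y) by move=> [s w]; exact: Pnext.
  by exists (fun s w => Y (s, w)) => s w; exact: (YP (s, w)).
(* [W s] is final up to time s and still constantly x afterwards; w* is its diagonal. *)
pose W := fix W s : Omega := if s is s'.+1 then update s (W s') (Y s' (W s')) else cst x.
have PW s : P s (W s).
  elim: s => [|s IH]; last exact: PY.
  exists e => // i; rewrite (le_trans (eB i))// (cylinder_measureE (cB i)).
pose w t := W t t.
have Ww s i : (i <= s)%N -> W s i = w i.
  elim: s => [|s IH]; first by rewrite leqn0 => /eqP ->.
  rewrite leq_eqVlt => /predU1P[->//|si] /=.
  by rewrite updateE ltn_eqF// IH.
exists w => i _.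
have [a a0 /(_ i)] := PW (c i).
rewrite /M iterated_integral_past; last exact: depends_upto_indic.
rewrite lee_fin indicE; case: (boolP (_ \in _)) => [|_]; last by rewrite leNgt a0.
by rewrite inE (cB i _ w)// => j /Ww.
Qed.

(** Finite additivity reduces the claim to continuity at the empty set. The remainders [B k]
    decrease to the empty set, so by [shrinking_meet] their measures cannot have a positive
    limit. *)
Let mu_semi_sigma_additive : semi_sigma_additive mu.
Proof.
move=> F mF tF mUF.
pose B k : set C := (\bigcup_i F i) `\` \big[setU/set0]_(i < k) F i.
have mBig k : measurable (\big[setU/set0]_(i < k) F i : set C).
  by apply: bigsetU_measurable.
have mB k : measurable (B k) by exact: measurableD.
have dB k : B k.+1 `<=` B k.
  by move=> w [UFw nFw]; split => // Fw; apply: nFw; rewrite big_ord_recr/=; left.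
have B0 : (fun k => mu (B k)) @ \oo --> 0%E.
  set u := fun k => _.
  have du : nonincreasing_seq u.
    by apply/nonincreasing_seqP => k; apply: mu_le.
  have := ereal_nonincreasing_cvgn du; set l := ereal_inf _ => ul.
  have l0 : (0 <= l)%E by apply/ereal_infP => _ [k _ <-]; exact: mu_ge0.
  have [<-//|l0'] := eqVneq l 0%E; exfalso.
  have lp : (0 < l)%E by rewrite lt_def l0' l0.
  have lfin : l \is a fin_num.
    rewrite ge0_fin_numE//; apply: (@le_lt_trans _ _ (u 0%N)).
      by apply: ereal_inf_lbound; exists 0%N.
    by apply: le_lt_trans (mu_le1 (mB 0%N)) _; rewrite ltry.
  have [|k|w Bw] := @shrinking_meet B (fine l) mB dB.
  - by rewrite -lte_fin fineK.
  - by rewrite fineK//; apply: ereal_inf_lbound; exists k.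
  have [[i _ Fi] _] := Bw 0%N Logic.I.
  have [_ nF] := Bw i.+1 Logic.I.
  by apply: nF; rewrite big_ord_recr/=; right.
have mufin A : measurable A -> mu A \is a fin_num.
  move=> mA; rewrite ge0_fin_numE//.
  by apply: le_lt_trans (mu_le1 mA) _; rewrite ltry.
have -> : (fun k => \sum_(0 <= i < k) mu (F i))%E =
    (fun k => mu (\bigcup_i F i) - mu (B k))%E.
  apply/funext => k; rewrite sum_mu//.
  have subU : \big[setU/set0]_(i < k) F i `<=` \bigcup_i F i.
    by rewrite -bigcup_mkord; exact: bigcup_subset.
  have -> : mu (\bigcup_i F i) = (mu (\big[setU/set0]_(i < k) F i) + mu (B k))%E.
    rewrite -muU ?setDUK//; apply/disj_setPS => w [Fw [_ nFw]]; exact: nFw.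
  by rewrite addeK// mufin.
rewrite -[X in _ --> X]sube0; apply: cvgeB => //; last exact: cvg_cst.
by rewrite fin_num_adde_defl.
Qed.

HB.instance Definition _ := isMeasure.Build _ _ _ mu mu0 mu_ge0 mu_semi_sigma_additive.

Lemma cylinder_sigma_algebra (B : set Omega) : measurable B ->
  <<s @measurable _ C >> B.
Proof.
apply: smallest_sub; first exact: smallest_sigma_algebra.
move=> _ [t _ [A mA <-]]; apply: sub_sigma_algebra; split.
  by rewrite -[X in measurable X]setTI; exact: (coord_measurable t _ mA).
by exists t => w w' /(_ t (leqnn t)) /= ->.
Qed.

(** Restated on [Omega], to become a measure for the product sigma-algebra instead of the one
    generated by [cylinder_space]. *)
Definition path_law (B : set Omega) : \bar R := measure_extension mu B.

Let path_law0 : path_law set0 = 0%E. Proof. exact: measure0. Qed.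

Let path_law_ge0 B : (0 <= path_law B)%E. Proof. exact: measure_ge0. Qed.

Let path_law_sigma_additive : semi_sigma_additive path_law.
Proof.
move=> F mF tF mUF; apply: measure_semi_sigma_additive => //.
  by move=> i; exact: cylinder_sigma_algebra.
exact: cylinder_sigma_algebra.
Qed.

HB.instance Definition _ := isMeasure.Build _ _ _ path_law
  path_law0 path_law_ge0 path_law_sigma_additive.

Let path_lawT : path_law setT = 1%E.
Proof. by rewrite /path_law /measure_extension measurable_mu_extE. Qed.

HB.instance Definition _ := Measure_isProbability.Build _ _ _ path_law path_lawT.

Theorem is_kernel_law_exists : exists P : probability Omega R, is_kernel_law x K P.
Proof.
exists path_law => k B mB kB.
(* [is_kernel_law] states an implication for all pairs of paths. Exchanging the paths makes it an
   equality of propositions. *)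
have dB : depends_upto k B.
  by move=> w w' ww'; apply/propext; split; apply: kB => // i /ww'.
rewrite /= /path_law /measure_extension measurable_mu_extE; last by split => //; exists k.
exact: cylinder_measureE.
Qed.

End ionescu_tulcea.

(** * The Markov property of kernel laws *)

Section next_state_kernel.
Context {R : realType} {n : nat} {E : set 'rV[R]_n} {E0 : E !=set0}.
Local Notation S := (borel_subspace E0).
Local Notation Omega := (trajectory E0).
Context (K : nat -> S -> probability S R).

(** The law of the path z.2 after its coordinate s + 1 is redrawn. The factor [unit] is the source
    of the first kernel in the composition [mkcomp] of [markov_step]. *)
Definition next_law (mK : measurable_kernels K) s (z : unit * Omega) (B : set Omega) :
  \bar R := K s (z.2 s) (update s.+1 z.2 @^-1` B).

Hypothesis mK : measurable_kernels K.

Let next_law0 s z : next_law mK s z set0 = 0%E.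
Proof. by rewrite /next_law preimage_set0 measure0. Qed.

Let next_law_ge0 s z B : (0 <= next_law mK s z B)%E.
Proof. exact: measure_ge0. Qed.

Let next_law_sigma_additive s z : semi_sigma_additive (next_law mK s z).
Proof.
move=> F mF tF mUF.
have mu : measurable_fun setT (update s.+1 z.2) by exact: update_section_measurable.
have mpre B : measurable B -> measurable (update s.+1 z.2 @^-1` B).
  by move=> mB; rewrite -[X in measurable X]setTI; exact: mu.
rewrite /next_law preimage_bigcup; apply: measure_semi_sigma_additive.
- by move=> i; exact: mpre.
- apply/trivIsetP => i j _ _ ij; rewrite -preimage_setI.
  by move/trivIsetP : tF => -> //; rewrite preimage_set0.
- by rewrite -preimage_bigcup; exact: mpre.
Qed.

HB.instance Definition _ s z := isMeasure.Build _ _ _ (next_law mK s z)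
  (next_law0 s z) (next_law_ge0 s z) (@next_law_sigma_additive s z).

Definition next_kernel s : unit * Omega -> {measure set Omega -> \bar R} := next_law mK s.

Lemma integral_next_law s z (f : Omega -> \bar R) : measurable_fun setT f ->
  (forall w, 0 <= f w)%E ->
  (\int[next_kernel s z]_w f w = \int[K s (z.2 s)]_y f (update s.+1 z.2 y))%E.
Proof.
move=> mf f0; apply/esym.
by apply: ge0_integral_law => //; exact: update_section_measurable.
Qed.

Let measurable_next s U : measurable U -> measurable_fun setT (next_kernel s ^~ U).
Proof.
move=> mU.
have -> : next_kernel s ^~ U =
    iterated_integral K s 1 (fun w => (\1_U w)%:E) \o snd.
  apply/funext => z /=; have := @integral_next_law s z (fun w => (\1_U w)%:E).
  by rewrite integral_indic// setIT; apply => //; exact: indic_measurable.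
apply: measurableT_comp; last exact: measurable_snd.
by apply: iterated_integral_measurable => //; exact: indic_measurable.
Qed.

HB.instance Definition _ s := isKernel.Build _ _ _ _ R (next_kernel s) (measurable_next s).

Let next_prob s z : next_kernel s z setT = 1%E.
Proof. by rewrite /next_kernel/= /next_law preimage_setT probability_setT. Qed.

HB.instance Definition _ s := Kernel_isProbability.Build _ _ _ _ R (next_kernel s) (next_prob s).

End next_state_kernel.

Section markov_property.
Context {R : realType} {n : nat} {E : set 'rV[R]_n} {E0 : E !=set0}.
Local Notation S := (borel_subspace E0).
Local Notation Omega := (trajectory E0).
Context (K : nat -> S -> probability S R) (mK : measurable_kernels K).
Context (x : S) (P : probability Omega R) (PK : is_kernel_law x K P).
Local Notation J := (iterated_integral K).

Definition stopped (k : nat) (w : Omega) : Omega := fun t => w (minn t k).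

Lemma stopped_measurable k : measurable_fun setT (stopped k).
Proof. by apply: trajectory_measurable => t; exact: coord_measurable. Qed.

Lemma depends_upto_stopped {V : Type} k (f : Omega -> V) :
  depends_upto k f -> f \o stopped k = f.
Proof.
by move=> kf; apply/funext => w; apply: kf => i ik; rewrite /stopped (minn_idPl ik).
Qed.

Lemma stopped_depends_upto k (B : set Omega) : depends_upto k (stopped k @^-1` B).
Proof.
move=> w w' ww'; rewrite /preimage/=; congr B.
by apply/funext => t; apply: ww'; exact: geq_minr.
Qed.

Lemma kernel_lawE k (B : set Omega) : measurable B -> depends_upto k B ->
  P B = J 0 k (fun w => (\1_B w)%:E) (cst x).
Proof. by move=> mB kB; apply: PK => // w w' /kB ->. Qed.

(** Measures that agree on the events up to time k have the same image under [stopped k], and f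
    factors through [stopped k]. *)
Let stoppedE (mu : {measure set Omega -> \bar R}) k (f : Omega -> \bar R) :
  (forall B, measurable B -> depends_upto k B -> P B = mu B) ->
  measurable_fun setT f -> (forall w, 0 <= f w)%E -> depends_upto k f ->
  (\int[P]_w f w = \int[mu]_w f w)%E.
Proof.
move=> Pmu mf f0 kf; rewrite -(depends_upto_stopped kf).
have mpre B : measurable B -> measurable (stopped k @^-1` B).
  by move=> mB; rewrite -[X in measurable X]setTI; exact: stopped_measurable.
transitivity (\int[pushforward mu (stopped k)]_w f w)%E.
  apply: (@ge0_integral_law _ _ _ _ _ P (pushforward mu (stopped k)) (stopped k)) => //;
    try exact: stopped_measurable.
  by move=> ? B mB; apply: Pmu; [exact: mpre|exact: stopped_depends_upto].
rewrite ge0_integral_pushforward// ?preimage_setT//; exact: stopped_measurable.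
Qed.

Let depends_upto_step k (f : Omega -> \bar R) : depends_upto k.+1 f ->
  depends_upto k (J k 1 f).
Proof.
move=> kf w w' ww' /=; rewrite (ww' k)//; apply: eq_integral => y _.
apply: kf => i; rewrite leq_eqVlt ltnS /=.
by case: eqP => //= _ ik; exact: ww'.
Qed.

(** The measure [nu] draws a path from P and redraws coordinate k + 1. The integral formula at level
    k shows that it agrees with P on the events up to k + 1. That formula is a premise because the
    induction in [integral_kernel_law] runs through this step, and [markov_property] uses the step
    again. *)
Let markov_step k (f : Omega -> \bar R) :
  (forall g, measurable_fun setT g -> (forall w, 0 <= g w)%E -> depends_upto k g ->
     \int[P]_w g w = J 0 k g (cst x))%E ->
  measurable_fun setT f -> (forall w, 0 <= f w)%E -> depends_upto k.+1 f ->
  (\int[P]_w f w = \int[P]_w \int[K k (w k)]_y f (update k.+1 w y))%E.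
Proof.
move=> IH mf f0 kf.
pose l := kprobability (measurable_cst (P : pprobability Omega R) : measurable_fun [set: unit] _).
pose nu : {measure set Omega -> \bar R} := mkcomp l (next_kernel mK k) tt.
rewrite (@stoppedE nu k.+1)//; first last.
  move=> B mB kB; rewrite (kernel_lawE mB kB) -addn1 iterated_integral_comp add0n.
  rewrite -IH; last 3 first.
  - by apply: iterated_integral_measurable => //; exact: indic_measurable.
  - by move=> w; exact: iterated_integral_ge0.
  - exact/depends_upto_step/depends_upto_indic.
  rewrite /nu/= /kcomp; apply: eq_integral => w _ /=.
  have := @integral_next_law _ _ _ _ _ mK k (tt, w) (fun w => (\1_B w)%:E).
  by rewrite integral_indic// setIT => H; apply/esym/H => //; exact: indic_measurable.
rewrite /nu integral_kcomp//; apply: eq_integral => w _.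
by rewrite integral_next_law.
Qed.

Lemma integral_kernel_law k (f : Omega -> \bar R) :
  measurable_fun setT f -> (forall w, 0 <= f w)%E -> depends_upto k f ->
  (\int[P]_w f w = J 0 k f (cst x))%E.
Proof.
elim: k f => [|k IH] f mf f0 kf.
  rewrite (@stoppedE (dirac (cst x : Omega)) 0%N)//; first by rewrite integral_dirac// diracT mul1e.
  by move=> B mB kB; rewrite (kernel_lawE mB kB).
rewrite -addn1 iterated_integral_comp add0n -(IH (J k 1 f)).
- exact: markov_step.
- exact: (iterated_integral_measurable mK).
- by move=> w; exact: iterated_integral_ge0.
- exact: depends_upto_step.
Qed.

Lemma markov_property t (g : S * S -> \bar R) : measurable_fun setT g ->
  (forall z, 0 <= g z)%E ->
  (\int[P]_w g (w t, w t.+1) = \int[P]_w \int[K t (w t)]_y g (w t, y))%E.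
Proof.
move=> mg g0; have mg' : measurable_fun setT (fun w : Omega => g (w t, w t.+1)).
  apply: (measurableT_comp mg); apply/measurable_fun_pairP.
  by split; exact: coord_measurable.
have dg : depends_upto t.+1 (fun w : Omega => g (w t, w t.+1)).
  by move=> w w' ww'; rewrite !ww'.
rewrite (@markov_step t _ (@integral_kernel_law t) mg' (fun w => g0 _) dg).
apply: eq_integral => w _; apply: eq_integral => y _.
by rewrite !updateE eqxx ltn_eqF.
Qed.

End markov_property.

(** * Discounted expectations *)

Section weighted_expectations.
Context {R : realType} {n : nat} {E : set 'rV[R]_n} {E0 : E !=set0}.
Local Notation S := (borel_subspace E0).
Local Notation Omega := (trajectory E0).
Context (K : nat -> S -> probability S R) (mK : measurable_kernels K).
Context (x : S) (P : probability Omega R) (PK : is_kernel_law x K P).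
Context (W : S -> R) (C : R).
Hypothesis mW : measurable_fun setT W.
Hypothesis W0 : forall y, 0 <= W y.
Hypothesis C0 : 0 <= C.
Hypothesis KW : forall t y, (\int[K t y]_z (W z)%:E <= (C * W y)%:E)%E.

Let mWE : measurable_fun setT (EFin \o W).
Proof. exact/measurable_EFinP. Qed.

Let mWt t : measurable_fun setT (fun w : Omega => (W (w t))%:E).
Proof. exact: (measurableT_comp mWE (coord_measurable t)). Qed.

Lemma expectation_weight t : (\int[P]_w (W (w t))%:E <= (C ^+ t * W x)%:E)%E.
Proof.
elim: t => [|t IH].
  rewrite (integral_kernel_law mK PK (k := 0%N) (f := fun w => (W (w 0%N))%:E))//=.
  - by rewrite expr0 mul1r.
  - by move=> w; rewrite lee_fin.
  - by move=> w w' ->.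
rewrite (markov_property mK PK t (g := fun z => (W z.2)%:E))/=; last 2 first.
- exact: (measurableT_comp mWE measurable_snd).
- by move=> z; rewrite lee_fin.
apply: (@le_trans _ _ (\int[P]_w (C%:E * (W (w t))%:E))%E).
  apply: ge0_le_integral => //.
  - by move=> w _; apply: integral_ge0 => y _; rewrite lee_fin.
  - apply: (@measurable_integral_kernel _ _ _ _ _ mK t (fun z => (W z.2)%:E)).
      by move=> z; rewrite lee_fin.
    exact: (measurableT_comp mWE measurable_snd).
  - exact: measurable_funeM.
rewrite ge0_integralZl//; last by move=> w _; rewrite lee_fin.
rewrite exprS -mulrA EFinM; apply: lee_wpmul2l => //.
Qed.

Lemma weighted_integrable t (f : Omega -> R) (a b : R) : measurable_fun setT f ->
  (forall w, `|f w| <= a * W (w t) + b * W (w t.+1)) ->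
  P.-integrable setT (EFin \o f).
Proof.
move=> mf fab.
have WI s : P.-integrable setT (EFin \o (fun w : Omega => W (w s))).
  apply/integrableP; split; first exact: mWt.
  under eq_integral do rewrite /= ger0_norm//.
  by apply: le_lt_trans (expectation_weight s) _; rewrite ltry.
apply: (@le_integrable _ _ _ _ _ _ _
  (EFin \o (fun w : Omega => a * W (w t) + b * W (w t.+1)))) => //.
- exact/measurable_EFinP.
- by move=> w _ /=; rewrite lee_fin (le_trans (fab w))// ler_norm.
- exact: (integrableD _ (integrableZl measurableT a (WI t)) (integrableZl measurableT b (WI t.+1))).
Qed.

Lemma kernel_integrable t y (f : S -> R) (a b : R) : measurable_fun setT f ->
  (forall z, `|f z| <= a + b * W z) ->
  (K t y).-integrable setT (EFin \o f).
Proof.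
move=> mf fab.
have WI : (K t y).-integrable setT (EFin \o W).
  apply/integrableP; split => //.
  under eq_integral do rewrite /= ger0_norm//.
  by apply: le_lt_trans (KW t y) _; rewrite ltry.
apply: (@le_integrable _ _ _ _ _ _ _ (EFin \o (fun z => a + b * W z))) => //.
- exact/measurable_EFinP.
- by move=> z _ /=; rewrite lee_fin (le_trans (fab z))// ler_norm.
- exact: (integrableD _ (cst_integrable _ a) (integrableZl measurableT b WI)).
Qed.

Section step.
Context (t : nat) (h : S -> S -> R) (u : S -> R) (c c' : R).
Hypotheses (mh : measurable_fun setT (fun z : S * S => h z.1 z.2))
  (mu : measurable_fun setT u) (c0 : 0 <= c) (c'0 : 0 <= c').
Hypothesis hc : forall y z, `|h y z| <= c * (W y + W z).
Hypothesis uc : forall y, `|u y| <= c' * W y.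

Lemma measurable_two_steps (f : S -> S -> R) :
  measurable_fun setT (fun z : S * S => f z.1 z.2) ->
  measurable_fun setT (fun w : Omega => f (w t) (w t.+1)).
Proof.
move=> mf; apply: (measurableT_comp mf (g := fun w : Omega => (w t, w t.+1))).
by apply/measurable_fun_pairP; split; exact: coord_measurable.
Qed.

(* Adding b to both sides reduces the claim to nonnegative functions. *)
Lemma expectation_step_le : (forall y, \int[K t y]_z h y z <= u y) ->
  \int[P]_w h (w t) (w t.+1) <= \int[P]_w u (w t).
Proof.
move=> hu.
pose b y z := c * (W y + W z) + c' * W y.
have b0 y z : 0 <= b y z by rewrite addr_ge0// mulr_ge0// addr_ge0.
have hb0 y z : 0 <= h y z + b y z.
  have := hc y z; rewrite ler_norml => /andP[+ _].
  by have := mulr_ge0 c'0 (W0 y); rewrite /b; lra.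
have ub0 y z : 0 <= u y + b y z.
  have := uc y; rewrite ler_norml => /andP[+ _].
  have := mulr_ge0 c0 (addr_ge0 (W0 y) (W0 z)); rewrite /b; lra.
have mW1 : measurable_fun setT (fun z : S * S => W z.1).
  by apply: (measurableT_comp mW); exact: measurable_fst.
have mW2 : measurable_fun setT (fun z : S * S => W z.2).
  by apply: (measurableT_comp mW); exact: measurable_snd.
have mb : measurable_fun setT (fun z : S * S => b z.1 z.2).
  apply: measurable_funD; last exact: measurable_funM.
  by apply: measurable_funM => //; exact: measurable_funD.
have mu1 : measurable_fun setT (fun z : S * S => u z.1).
  by apply: (measurableT_comp mu); exact: measurable_fst.
have mhb : measurable_fun setT (fun z : S * S => (h z.1 z.2 + b z.1 z.2)%:E).
  by apply/measurable_EFinP; exact: measurable_funD.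
have mub : measurable_fun setT (fun z : S * S => (u z.1 + b z.1 z.2)%:E).
  by apply/measurable_EFinP; exact: measurable_funD.
have msec (f : S -> S -> R) : measurable_fun setT (fun z : S * S => f z.1 z.2) ->
    forall y, measurable_fun setT (f y).
  by move=> mf y; exact: (measurable_fun_pair2 y mf).
have Kh y : (K t y).-integrable setT (EFin \o h y).
  apply: (@kernel_integrable _ _ _ (c * W y) c); first exact: msec.
  by move=> z; rewrite -mulrDr.
have Kb y : (K t y).-integrable setT (EFin \o b y).
  apply: (@kernel_integrable _ _ _ (c * W y + c' * W y) c); first exact: msec.
  by move=> z; rewrite ger0_norm// /b mulrDr; lra.
have Ph : P.-integrable setT (EFin \o (fun w : Omega => h (w t) (w t.+1))).
  apply: (@weighted_integrable t _ c c); first exact: measurable_two_steps.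
  by move=> w; rewrite -mulrDr.
have Pb : P.-integrable setT (EFin \o (fun w : Omega => b (w t) (w t.+1))).
  apply: (@weighted_integrable t _ (c + c') c); first exact: measurable_two_steps.
  by move=> w; rewrite ger0_norm// /b; lra.
have Pu : P.-integrable setT (EFin \o (fun w : Omega => u (w t))).
  apply: (@weighted_integrable t _ c' 0).
    by apply: (measurableT_comp mu); exact: coord_measurable.
  by move=> w; rewrite mul0r addr0.
have key : (\int[P]_w (h (w t) (w t.+1) + b (w t) (w t.+1))%:E <=
            \int[P]_w (u (w t) + b (w t) (w t.+1))%:E)%E.
  rewrite (markov_property mK PK t (g := fun z => (h z.1 z.2 + b z.1 z.2)%:E) mhb);
    last by move=> z; rewrite lee_fin.
  rewrite (markov_property mK PK t (g := fun z => (u z.1 + b z.1 z.2)%:E) mub);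
    last by move=> z; rewrite lee_fin.
  apply: ge0_le_integral => //.
  - by move=> w _; apply: integral_ge0 => z _ /=; rewrite lee_fin.
  - apply: (@measurable_integral_kernel _ _ _ _ _ mK t
      (fun z => (h (z.1 t) z.2 + b (z.1 t) z.2)%:E)).
      by move=> z; rewrite lee_fin.
    apply: (measurableT_comp mhb (g := fun z : Omega * S => (z.1 t, z.2))).
    apply/measurable_fun_pairP; split; last exact: measurable_snd.
    by apply: (measurableT_comp (coord_measurable t)); exact: measurable_fst.
  - apply: (@measurable_integral_kernel _ _ _ _ _ mK t
      (fun z => (u (z.1 t) + b (z.1 t) z.2)%:E)).
      by move=> z; rewrite lee_fin.
    apply: (measurableT_comp mub (g := fun z : Omega * S => (z.1 t, z.2))).
    apply/measurable_fun_pairP; split; last exact: measurable_snd.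
    by apply: (measurableT_comp (coord_measurable t)); exact: measurable_fst.
  - move=> w _ /=; set y := w t.
    have i1 := integrableD measurableT (Kh y) (Kb y).
    have i2 := integrableD measurableT (cst_integrable (K t y) (u y)) (Kb y).
    rewrite -[leLHS]fineK; last exact: (integrable_fin_num measurableT i1).
    rewrite -[leRHS]fineK; last exact: (integrable_fin_num measurableT i2).
    rewrite lee_fin -/(Rintegral _ _ _) -/(Rintegral _ _ _).
    rewrite (RintegralD measurableT (Kh y) (Kb y)).
    rewrite (RintegralD measurableT (cst_integrable (K t y) (u y)) (Kb y)) lerD2r.
    by rewrite Rintegral_cst//= probability_setT mulr1.
have := fine_le _ _ key.
rewrite -/(Rintegral _ _ _) -/(Rintegral _ _ _).
rewrite (RintegralD measurableT Ph Pb) (RintegralD measurableT Pu Pb) lerD2r; apply.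
- exact: (integrable_fin_num measurableT (integrableD measurableT Ph Pb)).
- exact: (integrable_fin_num measurableT (integrableD measurableT Pu Pb)).
Qed.

End step.
End weighted_expectations.

(** Where the sequence diverges, [limn] is a default constant. The set of convergence is measurable
    by the Cauchy criterion, and the two sets are treated separately. *)
Lemma measurable_fun_limn d (T : measurableType d) (R : realType) (u : nat -> T -> R) :
  (forall i, measurable_fun setT (u i)) ->
  measurable_fun setT (fun w => limn (u ^~ w) : R).
Proof.
move=> mu.
pose D := [set w | cvgn (u ^~ w)].
have mD : measurable D.
  have -> : D = \bigcap_k \bigcup_N \bigcap_(m in [set m | (N <= m)%N])
      [set w | `|u N w - u m w| < k.+1%:R^-1].
    apply/seteqP; split => [w /= /cvg_ex[l ul] k _|w /= Dw].
      have k0 : (0 : R) < k.+1%:R^-1 / 2 by rewrite divr_gt0// invr_gt0.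
      move/cvgrPdist_lt : ul => /(_ _ k0)[N _ HN].
      exists N => // m /= Nm.
      have h1 := HN N (leqnn N); have h2 := HN m Nm.
      have -> : u N w - u m w = (l - u m w) - (l - u N w) by ring.
      rewrite (le_lt_trans (ler_normB _ _))//.
      by rewrite (splitr k.+1%:R^-1) ltrD.
    apply/cauchy_cvgP/cauchy_exP => e e0.
    have [k _ /(_ k (leqnn k)) /= ke] := near_infty_natSinv_lt (PosNum e0).
    have [N _ HN] := Dw k Logic.I; exists (u N w).
    by exists N => // m /= Nm; apply: lt_trans ke; exact: HN.
  apply: bigcapT_measurable => k; apply: bigcupT_measurable => N.
  apply: bigcap_measurable; first by exists N => /=.
  move=> m _; have : measurable_fun setT (fun w => `|u N w - u m w|).
    by apply: measurableT_comp => //; exact: measurable_funB.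
  move=> /(_ measurableT _ (measurable_itv `]-oo, k.+1%:R^-1[)); rewrite setTI.
  by congr measurable; apply/seteqP; split => t /=; rewrite in_itv.
rewrite -(setUv D); apply/measurable_funU => //; first exact: measurableC.
split.
  apply: (@measurable_fun_cvg _ _ _ D u); last by move=> w.
  by move=> m; exact: measurable_funTS.
apply: (@eq_measurable_fun _ _ _ _ _ (cst (point : R))); last exact: measurable_cst.
move=> w; rewrite inE => nD; apply/esym; apply: getPN => l ul.
by apply: nD; apply/cvg_ex; exists l.
Qed.

(* The tail of sum_t D_t with |D_t| <= M g^t. *)
Lemma geometric_tail (R : realType) (D : nat -> R) (M g : R) : 0 <= g < 1 -> 0 <= M ->
  (forall t, `|D t| <= M * g ^+ t) ->
  forall N m, (N <= m)%N ->
  `|\sum_(0 <= t < m) D t - \sum_(0 <= t < N) D t| <= M * g ^+ N / (1 - g).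
Proof.
move=> /andP[g0 g1] M0 DM N m Nm; have g1' : 0 < 1 - g by rewrite subr_gt0.
have : `|\sum_(0 <= t < m) D t - \sum_(0 <= t < N) D t| <=
    (M * g ^+ N - M * g ^+ m) / (1 - g).
  rewrite -(subnK Nm); elim: (m - N)%N => [|k IH].
    by rewrite add0n !subrr normr0 mul0r.
  rewrite addSn big_nat_recr//= addrAC.
  apply: le_trans (ler_normD _ _) _.
  have -> : (M * g ^+ N - M * g ^+ (k + N).+1) / (1 - g) =
      (M * g ^+ N - M * g ^+ (k + N)) / (1 - g) + M * g ^+ (k + N).
    by rewrite exprS; field; rewrite gt_eqF.
  exact: lerD.
move=> /le_trans; apply; rewrite ler_wpM2r ?invr_ge0 ?(ltW g1')//.
by rewrite gerBl mulr_ge0// exprn_ge0.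
Qed.

Section series_expectation.
Context d (T : measurableType d) (R : realType) (mu : {measure set T -> \bar R}).
Context (rho : nat -> T -> R) (M g : R).
Hypotheses (mrho : forall t, measurable_fun setT (rho t))
  (g01 : 0 <= g < 1) (M0 : 0 <= M)
  (rhoM : forall t, (\int[mu]_w `|rho t w|%:E <= (M * g ^+ t)%:E)%E).

Let rho_integrable t : mu.-integrable setT (EFin \o rho t).
Proof.
apply/integrableP; split; first exact/measurable_EFinP.
by apply: le_lt_trans (rhoM t) _; rewrite ltry.
Qed.

Let norm_rho_Rintegral t : `|\int[mu]_w rho t w| <= M * g ^+ t.
Proof.
rewrite -lee_fin EFin_normr_Rintegral//.
apply: le_trans (rhoM t); apply: le_abse_integral => //; exact/measurable_EFinP.
Qed.

(** Dominated convergence with the sum [G] of the absolute values. [G] is integrable by the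
    geometric bound, hence finite almost everywhere, and there the series converges absolutely. *)
Lemma series_expectation : exists2 e : R,
  (\int[mu]_w (limn (series (rho ^~ w)))%:E = e%:E)%E &
  forall N, `|e - \sum_(0 <= t < N) \int[mu]_w rho t w| <= M * g ^+ N / (1 - g).
Proof.
have [g0 g1] := andP g01.
pose G w := (\sum_(0 <= t <oo) `|rho t w|%:E)%E.
have mabs t : measurable_fun setT (fun w => `|rho t w|%:E).
  by apply/measurable_EFinP; exact: measurableT_comp.
have G0 w : (0 <= G w)%E by apply: nneseries_ge0.
have mG : measurable_fun setT G by apply: ge0_emeasurable_sum.
have intG : (\int[mu]_w G w <= (M / (1 - g))%:E)%E.
  rewrite integral_nneseries//; apply: lime_le.
    by apply: is_cvg_nneseries => t _ _; exact: integral_ge0.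
  apply: nearW => N; apply: (@le_trans _ _ (\sum_(0 <= t < N) (M * g ^+ t)%:E)%E).
    by apply: lee_sum => t _.
  rewrite sumEFin lee_fin.
  have h t : `|M * g ^+ t| <= M * g ^+ t by rewrite ger0_norm// mulr_ge0// exprn_ge0.
  have := geometric_tail g01 M0 h (leq0n N).
  rewrite [X in _ - X]big_geq// subr0 expr0 mulr1; apply: le_trans; exact: ler_norm.
have iG : mu.-integrable setT G.
  apply/integrableP; split => //.
  under eq_integral do rewrite gee0_abs//.
  by apply: le_lt_trans intG _; rewrite ltry.
have ae_cvg : {ae mu, forall w, setT w ->
    (fun N => (series (rho ^~ w) N)%:E) @ \oo --> (limn (series (rho ^~ w)))%:E}.
  have := integrable_ae measurableT iG; apply: filterS => w /(_ Logic.I) Gfin _.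
  apply: cvg_EFin; first by apply: nearW.
  suff : cvgn (series (rho ^~ w)) by [].
  apply: normed_cvg; apply: nondecreasing_is_cvgn.
    apply/nondecreasing_seqP => N.
    suff : \sum_(0 <= t < N) `|rho t w| <= \sum_(0 <= t < N.+1) `|rho t w| by [].
    by rewrite big_nat_recr//= lerDl.
  exists (fine (G w)) => _ [N _ <-].
  suff : \sum_(0 <= t < N) `|rho t w| <= fine (G w) by [].
  rewrite -lee_fin fineK// -sumEFin.
  by apply: nneseries_lim_ge => t _ _.
have mS N : measurable_fun setT (fun w => series (rho ^~ w) N).
  by apply: measurable_sum.
have [|||||intf _] := @dominated_convergence _ _ _ mu setT measurableT
  (fun N w => (series (rho ^~ w) N)%:E) (fun w => (limn (series (rho ^~ w)))%:E) G.
- by move=> N; exact/measurable_EFinP.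
- by apply/measurable_EFinP; exact: measurable_fun_limn.
- exact: ae_cvg.
- exact: iG.
- apply: aeW => w N _; rewrite /series/=.
  apply: (@le_trans _ _ (\sum_(0 <= t < N) `|rho t w|%:E)%E).
    by rewrite sumEFin lee_fin ler_norm_sum.
  by apply: nneseries_lim_ge => t _ _.
set I := (\int[mu]_w (limn _)%:E)%E.
have intS N : mu.-integrable setT (fun w => (series (rho ^~ w) N)%:E) /\
    (\int[mu]_w (series (rho ^~ w) N)%:E = (\sum_(0 <= t < N) \int[mu]_w rho t w)%:E)%E.
  rewrite /series/=; elim: N => [|N [IH1 IH2]].
    rewrite big_geq//; under eq_fun do rewrite big_geq//.
    by split; [exact: integrable0|exact: integral0].
  under eq_fun do rewrite big_nat_recr//= EFinD.
  split; first exact: (integrableD measurableT IH1 (rho_integrable N)).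
  rewrite big_nat_recr//= (integralD measurableT IH1 (rho_integrable N)) IH2 EFinD; congr (_ + _)%E.
  rewrite /Rintegral fineK//; exact: (integrable_fin_num measurableT (rho_integrable N)).
under eq_cvg do rewrite /= (intS _).2.
have Ifin : I \is a fin_num by exact: (integrable_fin_num measurableT intf).
rewrite -{1}(fineK Ifin) => /fine_cvg /= cvgI.
exists (fine I); first by rewrite fineK.
move=> N; set s := \sum_(_ <= _ < _) _.
have cvgN : `|\sum_(0 <= t < m) \int[mu]_w rho t w - s| @[m --> \oo] --> `|fine I - s|.
  by apply: cvg_norm; apply: cvgB => //; exact: cvg_cst.
rewrite -(cvg_lim _ cvgN)//; apply: limr_le; first exact: cvgP cvgN.
exists N => // m /= Nm; exact: (geometric_tail g01 M0 norm_rho_Rintegral).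
Qed.

End series_expectation.

Lemma RintegralN d (T : measurableType d) (R : realType) (mu : {measure set T -> \bar R})
    (f : T -> R) : mu.-integrable setT (EFin \o f) ->
  \int[mu]_x (- f x) = - \int[mu]_x f x.
Proof.
move=> fi; rewrite -mulN1r -RintegralZl//.
by apply: eq_Rintegral => x _; rewrite mulN1r.
Qed.

Section discounted_reward.
Context {R : realType} {n : nat} {E : set 'rV[R]_n} {E0 : E !=set0}.
Local Notation S := (borel_subspace E0).
Local Notation Omega := (trajectory E0).
Context (K : nat -> S -> probability S R) (mK : measurable_kernels K).
Context (x : S) (P : probability Omega R) (PK : is_kernel_law x K P).
Context (W : S -> R) (C : R).
Hypothesis mW : measurable_fun setT W.
Hypothesis W1 : forall y, 1 <= W y.
Hypothesis C0 : 0 <= C.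
Hypothesis KW : forall t y, (\int[K t y]_z (W z)%:E <= (C * W y)%:E)%E.
Context (rho : nat -> S -> S -> R) (c alpha : R).
Hypothesis mrho : forall t, measurable_fun setT (fun z : S * S => rho t z.1 z.2).
Hypothesis c0 : 0 <= c.
Hypothesis rhoc : forall t y z, `|rho t y z| <= c * (W y + W z).
Hypothesis alpha01 : 0 < alpha < 1.
Hypothesis alphaC : alpha * C < 1.

Let W0 y : 0 <= W y. Proof. exact: le_trans (W1 y). Qed.

Let alpha0 : 0 < alpha. Proof. by case/andP: alpha01. Qed.

Lemma expectation_start (f : S -> R) : measurable_fun setT f ->
  \int[P]_w f (w 0%N) = f x.
Proof.
move=> mf; rewrite (@Rintegral_law _ _ _ _ _ P (dirac x) (fun w : Omega => w 0%N))//.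
- by rewrite /Rintegral integral_dirac// ?diracT ?mul1e//; exact/measurable_EFinP.
- exact: coord_measurable.
- move=> B mB; apply: etrans (kernel_lawE PK (k := 0%N) _ _) _ => //.
    by rewrite -[X in measurable X]setTI; exact: (coord_measurable 0%N measurableT mB).
  by move=> w w' /(_ 0%N (leqnn _)) /= ww'; rewrite /preimage/= ww'.
Qed.

Let expected_reward t := \int[P]_w rho t (w t) (w t.+1).

(** By [expectation_weight], the reward at time t has discounted absolute expectation at most
    alpha^t c (C^t + C^(t+1)) W x = c (1 + C) W x (alpha C)^t. The tail of this geometric series
    from N on is [discount_bound] times (alpha C)^N. *)
Let discount_bound := c * (1 + C) * W x / (1 - alpha * C).

Lemma discounted_expectation : exists2 e : R,
  (\int[P]_w (limn (series (fun t => alpha ^+ t * rho t (w t) (w t.+1))))%:E = e%:E)%E &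
  forall N, `|e - \sum_(0 <= t < N) alpha ^+ t * expected_reward t| <=
    discount_bound * (alpha * C) ^+ N.
Proof.
pose u t (w : Omega) := alpha ^+ t * rho t (w t) (w t.+1).
have mr t : measurable_fun setT (fun w : Omega => rho t (w t) (w t.+1)).
  exact: (measurable_two_steps t (mrho t)).
have mu t : measurable_fun setT (u t) by exact: measurable_funM.
have ri t : P.-integrable setT (EFin \o (fun w : Omega => rho t (w t) (w t.+1))).
  apply: (weighted_integrable mK PK mW W0 C0 KW (t := t) (a := c) (b := c)) => // w.
  by rewrite -mulrDr.
have M0 : 0 <= c * (1 + C) * W x by rewrite !mulr_ge0// addr_ge0.
have g01 : 0 <= alpha * C < 1 by rewrite mulr_ge0// ltW.
have uM t : (\int[P]_w `|u t w|%:E <= (c * (1 + C) * W x * (alpha * C) ^+ t)%:E)%E.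
  have mWt s : measurable_fun setT (fun w : Omega => (W (w s))%:E).
    by apply/measurable_EFinP; exact: (measurableT_comp mW (coord_measurable s)).
  have at0 : 0 <= alpha ^+ t by rewrite exprn_ge0// ltW.
  apply: (@le_trans _ _ (\int[P]_w ((alpha ^+ t * c)%:E *
      ((W (w t))%:E + (W (w t.+1))%:E)))%E).
    apply: ge0_le_integral => //.
    - by apply/measurable_EFinP; exact: measurableT_comp.
    - by apply: measurable_funeM; exact: emeasurable_funD.
    - move=> w _; rewrite -EFinD -EFinM lee_fin normrM (ger0_norm at0) -mulrA.
      by rewrite ler_wpM2l.
  rewrite ge0_integralZl//; last 3 first.
  - exact: emeasurable_funD.
  - by move=> w _; rewrite adde_ge0// lee_fin.
  - by rewrite lee_fin mulr_ge0.
  rewrite ge0_integralD//; last 2 first.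
  - by move=> w _; rewrite lee_fin.
  - by move=> w _; rewrite lee_fin.
  have -> : c * (1 + C) * W x * (alpha * C) ^+ t =
      alpha ^+ t * c * (C ^+ t * W x + C ^+ t.+1 * W x).
    by rewrite exprMn exprS; ring.
  rewrite [leRHS]EFinM EFinD; apply: lee_wpmul2l; first by rewrite lee_fin mulr_ge0.
  by apply: leeD; exact: (expectation_weight mK PK mW W0 C0 KW).
have [e eE eN] := series_expectation mu g01 M0 uM.
exists e => // N; have := eN N.
under eq_bigr do rewrite RintegralZl//.
by rewrite /discount_bound mulrAC.
Qed.

Section dynamic_programming.
Context (N : nat) (v : nat -> S -> R) (c' : R).
Hypothesis c'0 : 0 <= c'.
Hypothesis mv : forall k, measurable_fun setT (v k).
Hypothesis vc : forall k y, `|v k y| <= c' * W y.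
Hypothesis v0 : forall y, v 0%N y = 0.

(** The index of [v] counts the steps to go: N - t at time t, and N - t.+1 after the transition. *)
Let h t y z := rho t y z + alpha * v (N - t.+1) z.
Let U t := \int[P]_w v (N - t) (w t).

Let mh t : measurable_fun setT (fun z : S * S => h t z.1 z.2).
Proof.
apply: measurable_funD => //; apply: measurable_funM => //.
exact: (measurableT_comp (mv _) measurable_snd).
Qed.

Let hc t y z : `|h t y z| <= (c + alpha * c') * (W y + W z).
Proof.
rewrite mulrDl; apply: le_trans (ler_normD _ _) _; apply: lerD => //.
rewrite normrM (gtr0_norm alpha0) -mulrA ler_wpM2l ?(ltW alpha0)//.
by rewrite (le_trans (vc _ _))// ler_wpM2l// lerDr.
Qed.

Let cc'0 : 0 <= c + alpha * c'.
Proof. by rewrite addr_ge0// mulr_ge0// ltW. Qed.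

Let rho_integrable t : P.-integrable setT (EFin \o (fun w : Omega => rho t (w t) (w t.+1))).
Proof.
apply: (weighted_integrable mK PK mW W0 C0 KW (t := t) (a := c) (b := c)).
  exact: (measurable_two_steps t (mrho t)).
by move=> w; rewrite -mulrDr.
Qed.

Let v_integrable k t : P.-integrable setT (EFin \o (fun w : Omega => v k (w t))).
Proof.
apply: (weighted_integrable mK PK mW W0 C0 KW (t := t) (a := c') (b := 0)).
  exact: (measurableT_comp (mv k) (coord_measurable t)).
by move=> w; rewrite mul0r addr0.
Qed.

Let expectation_h t : \int[P]_w h t (w t) (w t.+1) = expected_reward t + alpha * U t.+1.
Proof.
rewrite RintegralD//; first by rewrite RintegralZl.
exact: (integrableZl measurableT alpha (v_integrable (N - t.+1) t.+1)).
Qed.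

Let U0 : U 0%N = v N x. Proof. by rewrite /U subn0 expectation_start. Qed.

Let UN : U N = 0.
Proof.
rewrite /U subnn; transitivity (\int[P]_(w in setT) (0 : R)).
  by apply: eq_Rintegral => w _; rewrite v0.
by rewrite Rintegral_cst// mul0r.
Qed.

Lemma discounted_reward_le :
  (forall t y, (t < N)%N -> \int[K t y]_z h t y z <= v (N - t) y) ->
  \sum_(0 <= t < N) alpha ^+ t * expected_reward t <= v N x.
Proof.
move=> hv.
(* The reward collected so far plus the discounted expected value still to come does not increase
   with k. It starts at v N x and ends with the whole reward. *)
suff H k : (k <= N)%N -> \sum_(0 <= t < k) alpha ^+ t * expected_reward t
    + alpha ^+ k * U k <= v N x.
  by have := H N (leqnn N); rewrite UN mulr0 addr0.
elim: k => [|k IH] kN; first by rewrite big_geq// add0r expr0 mul1r U0.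
apply: le_trans (IH (ltnW kN)).
rewrite big_nat_recr//= -addrA lerD2l exprSr -mulrA -mulrDr.
rewrite ler_wpM2l ?exprn_ge0 ?(ltW alpha0)// -expectation_h.
apply: (expectation_step_le mK PK mW W0 C0 KW (mh k) (mv (N - k)) cc'0 c'0 (hc k)) => //.
by move=> y; exact: hv.
Qed.

Lemma discounted_reward_ge (kappa : R) : 0 <= kappa ->
  (forall t y, (t < N)%N -> v (N - t) y - kappa <= \int[K t y]_z h t y z) ->
  v N x - kappa / (1 - alpha) <= \sum_(0 <= t < N) alpha ^+ t * expected_reward t.
Proof.
move=> kappa0 hv.
have a1 : 0 < 1 - alpha by rewrite subr_gt0; case/andP: alpha01.
have step k : (k < N)%N -> U k - kappa <= expected_reward k + alpha * U k.+1.
  move=> kN; rewrite -expectation_h.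
  have hi : P.-integrable setT (EFin \o (fun w : Omega => h k (w k) (w k.+1))).
    apply: (weighted_integrable mK PK mW W0 C0 KW (t := k)
      (a := c + alpha * c') (b := c + alpha * c')).
      exact: (measurable_two_steps k (mh k)).
    by move=> w; rewrite -mulrDr.
  have vki : P.-integrable setT (EFin \o (fun w : Omega => v (N - k) (w k) - kappa)).
    exact: (integrableB measurableT (v_integrable _ _) (cst_integrable P kappa)).
  (* Negation allows [expectation_step_le] to be used for the reverse inequality. The constant kappa
     is absorbed into the growth bound because W >= 1. *)
  rewrite -lerN2 -(RintegralN hi).
  have -> : - (U k - kappa) = \int[P]_w - (v (N - k) (w k) - kappa).
    rewrite RintegralN// (RintegralB measurableT (v_integrable _ _) (cst_integrable P kappa)).
    by rewrite Rintegral_cst//= probability_setT mulr1.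
  apply: (expectation_step_le mK PK mW W0 C0 KW (h := fun y z => - h k y z)
    (u := fun y => - (v (N - k) y - kappa)) (c := c + alpha * c') (c' := c' + kappa)) => //.
  - exact: measurable_funN.
  - by apply: measurable_funN; exact: measurable_funB.
  - exact: addr_ge0.
  - by move=> y z; rewrite normrN.
  - move=> y; rewrite normrN (le_trans (ler_normB _ _))// mulrDl lerD//.
    by rewrite ger0_norm// ler_peMr.
  - move=> y; have hyi : (K k y).-integrable setT (EFin \o h k y).
      apply: (kernel_integrable mW W0 KW k y
        (a := (c + alpha * c') * W y) (b := c + alpha * c')).
        exact: (measurable_fun_pair2 y (mh k)).
      by move=> z; rewrite -mulrDr.
    by rewrite RintegralN// lerN2 hv.
(* The loss kappa at time t is discounted by alpha^t, and these losses sum to kappa (1 - alpha^k) /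
   (1 - alpha) over k steps. *)
suff H k : (k <= N)%N -> v N x - kappa * (1 - alpha ^+ k) / (1 - alpha) <=
    \sum_(0 <= t < k) alpha ^+ t * expected_reward t + alpha ^+ k * U k.
  have := H N (leqnn N); rewrite UN mulr0 addr0; apply: le_trans.
  rewrite lerD2l lerN2 ler_wpM2r ?invr_ge0 ?(ltW a1)// ler_piMr// gerBl.
  by rewrite exprn_ge0// ltW.
elim: k => [|k IH] kN.
  by rewrite big_geq// add0r expr0 mul1r U0 subrr mulr0 mul0r subr0.
rewrite big_nat_recr//= exprSr.
have ak0 : 0 <= alpha ^+ k by rewrite exprn_ge0// ltW.
have := ler_wpM2l ak0 (step k kN); have := IH (ltnW kN).
have -> : kappa * (1 - alpha ^+ k * alpha) / (1 - alpha) =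
    kappa * (1 - alpha ^+ k) / (1 - alpha) + alpha ^+ k * kappa.
  by field; rewrite gt_eqF.
by lra.
Qed.

End dynamic_programming.
End discounted_reward.

(** * The Bellman operator of the true model *)

(** Selection of the least admissible index: index i is taken on [A i] minus the earlier sets. *)
Lemma measurable_first_index d (T : measurableType d) (A : nat -> set T) :
  (forall i, measurable (A i)) -> (forall x, exists i, A i x) ->
  exists2 f : T -> nat, (forall x, A (f x) x) & measurable_fun setT f.
Proof.
move=> mA Aex.
have Aex' x : exists i, `[<A i x>] by have [i Ai] := Aex x; exists i; exact/asboolP.
exists (fun x => ex_minn (Aex' x)).
  by move=> x; case: ex_minnP => i /asboolP.
move=> _ Y _; rewrite setTI.
rewrite (_ : _ @^-1` Y = \bigcup_(i in Y) (A i `\` \big[setU/set0]_(j < i) A j)).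
  apply: bigcup_measurable => i _; apply: measurableD => //.
  by apply: bigsetU_measurable.
apply/seteqP; split => [x /=|x [i Yi [Ai nA]] /=]; case: ex_minnP => j /asboolP Aj jmin.
  move=> Yj; exists j => //; split => //; rewrite -bigcup_mkord => -[i /= ij Ai].
  by have := jmin i (asboolT Ai); rewrite leqNgt ij.
suff -> : j = i by [].
apply/eqP; rewrite eqn_leq (jmin i (asboolT Ai)) leqNgt; apply/negP => ji.
by apply: nA; rewrite -bigcup_mkord; exists j.
Qed.

Section bellman.
Context {R : realType} {d m : nat} {X : set 'rV[R]_d} {A : set 'rV[R]_m}
  {X0 : X !=set0} {A0 : A !=set0}.
Local Notation SX := (borel_subspace X0).
Local Notation SA := (borel_subspace A0).
Context (T : SX -> SA -> probability SX R) (r : SX -> SA -> SX -> R).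
Context (alpha Lr LP c C : R) (W : SX -> R).
Hypothesis T1 : forall x a, finite_moment X0 1 (T x a).
Hypothesis TL : forall (f : SX -> R) L, 0 <= L -> lipschitz_fun f L ->
  forall x a x' a', `|(\int[T x a]_y f y) - (\int[T x' a']_y f y)| <=
    L * (LP * (pdist x x' + pdist a a')).
Hypothesis Lr0 : 0 <= Lr.
Hypothesis rL : forall x a y x' a' y', `|r x a y - r x' a' y'| <=
  Lr * (pdist x x' + pdist a a' + pdist y y').
Hypothesis mW : measurable_fun setT W.
Hypothesis W0 : forall y, 0 <= W y.
Hypothesis TW : forall x a, (\int[T x a]_z (W z)%:E <= (C * W x)%:E)%E.
Hypothesis c0 : 0 <= c.
Hypothesis C0 : 0 <= C.
Hypothesis rc : forall x a y, `|r x a y| <= c * (W x + W y).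
Hypothesis alpha0 : 0 < alpha.
Hypothesis LP0 : 0 <= LP.
Hypothesis alphaLP : alpha * LP < 1.
Hypothesis alphaC : alpha * C < 1.

(* [value_lip] solves L = Lr + (Lr + alpha * L) * LP, so that the Bellman operator
   preserves [value_lip]-Lipschitz functions. *)
Definition value_lip := Lr * (1 + LP) / (1 - alpha * LP).

Definition target_lip := Lr * (1 + alpha) / (1 - alpha * LP).

(** The solution G of G = c + (c + alpha G) C, so that the Bellman operator preserves the bound |v|
    <= G W. *)
Definition value_growth := c * (1 + C) / (1 - alpha * C).

Let alphaLP0 : 0 < 1 - alpha * LP. Proof. by rewrite subr_gt0. Qed.

Let alphaC0 : 0 < 1 - alpha * C. Proof. by rewrite subr_gt0. Qed.

Lemma value_lip_ge0 : 0 <= value_lip.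
Proof. by rewrite divr_ge0 ?(ltW alphaLP0)// mulr_ge0// addr_ge0. Qed.

Lemma target_lip_ge0 : 0 <= target_lip.
Proof. by rewrite divr_ge0 ?(ltW alphaLP0)// mulr_ge0// addr_ge0// ltW. Qed.

Lemma value_growth_ge0 : 0 <= value_growth.
Proof. by rewrite divr_ge0 ?(ltW alphaC0)// mulr_ge0// addr_ge0. Qed.

Let target_lipE : Lr + alpha * value_lip = target_lip.
Proof. by rewrite /value_lip /target_lip; field; rewrite gt_eqF. Qed.

Let value_lipE : Lr + target_lip * LP = value_lip.
Proof. by rewrite /value_lip /target_lip; field; rewrite gt_eqF. Qed.

Let value_growthE : c + (c + alpha * value_growth) * C = value_growth.
Proof. by rewrite /value_growth; field; rewrite gt_eqF. Qed.

Definition target (v : SX -> R) x a y := r x a y + alpha * v y.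

Definition qvalue (v : SX -> R) x a := \int[T x a]_y target v x a y.

Definition bellman (v : SX -> R) x := sup (range (qvalue v x)).

Definition value_iterate k := iter k bellman (cst 0).

Section operator.
Context (v : SX -> R).
Hypothesis vL : lipschitz_fun v value_lip.
Hypothesis vW : forall y, `|v y| <= value_growth * W y.

Lemma target_lipschitz x a : lipschitz_fun (target v x a) target_lip.
Proof.
move=> y y'; rewrite /target opprD addrACA -mulrBr.
apply: le_trans (ler_normD _ _) _.
rewrite normrM (gtr0_norm alpha0) -target_lipE mulrDl; apply: lerD.
  by have := rL x a y x a y'; rewrite !pdistxx !add0r.
by rewrite -mulrA ler_wpM2l// ltW.
Qed.

Let target_integrable x a x' a' :
  (T x a).-integrable setT (EFin \o target v x' a').
Proof. exact: lipschitz_integrable (T1 x a) target_lip_ge0 (target_lipschitz _ _). Qed.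

Lemma qvalue_lipschitz x a x' a' :
  `|qvalue v x a - qvalue v x' a'| <= value_lip * (pdist x x' + pdist a a').
Proof.
rewrite /qvalue; set D := pdist x x' + _.
set I := Rintegral _ _ _; set I' := Rintegral _ _ _.
(* The integrand is changed first, under the kernel [T x a], at cost Lr D. The kernel is changed
   next, under a fixed integrand, at cost [target_lip] LP D. *)
have -> : I - I' = (I - (\int[T x a]_y target v x' a' y)) +
    ((\int[T x a]_y target v x' a' y) - I') by rewrite addrA subrK.
apply: le_trans (ler_normD _ _) _; rewrite -value_lipE mulrDl; apply: lerD; last first.
  rewrite -mulrA; apply: TL; [exact: target_lip_ge0|exact: target_lipschitz].
rewrite -(RintegralB measurableT (target_integrable x a x a) (target_integrable x a x' a')).
have ib := integrableB measurableT (target_integrable x a x a) (target_integrable x a x' a').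
apply: le_trans (le_normr_Rintegral measurableT ib) _.
have <- : \int[T x a]_(y in setT) (Lr * D) = Lr * D.
  by rewrite Rintegral_cst//= probability_setT mulr1.
apply: le_Rintegral => //; first exact: (integrable_norm ib).
  exact: (cst_integrable (T x a) (Lr * D)).
move=> y _; rewrite /target opprD addrACA subrr addr0.
by have := rL x a y x' a' y; rewrite pdistxx addr0.
Qed.

Lemma qvalue_growth x a : `|qvalue v x a| <= value_growth * W x.
Proof.
apply: le_trans (le_normr_Rintegral measurableT (target_integrable x a x a)) _.
have iW : (T x a).-integrable setT (EFin \o (fun y => c * W x + (c + alpha * value_growth) * W y)).
  apply: (kernel_integrable (K := fun _ y => T y a) mW W0 (fun _ y => TW y a) 0%N x
    (a := c * W x) (b := c + alpha * value_growth)).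
    by apply: measurable_funD => //; exact: measurable_funM.
  move=> y; rewrite ger0_norm// addr_ge0// mulr_ge0// addr_ge0// mulr_ge0 ?value_growth_ge0//.
  exact: ltW.
have iW1 : (T x a).-integrable setT (EFin \o W).
  apply: (kernel_integrable (K := fun _ y => T y a) mW W0 (fun _ y => TW y a) 0%N x
    (a := 0) (b := 1)) => // y.
  by rewrite ger0_norm// add0r mul1r.
apply: (@le_trans _ _ (\int[T x a]_y (c * W x + (c + alpha * value_growth) * W y))).
  apply: le_Rintegral => //; first exact: (integrable_norm (target_integrable x a x a)).
  move=> y _; rewrite /target; apply: le_trans (ler_normD _ _) _.
  rewrite normrM (gtr0_norm alpha0) mulrDl addrA -mulrDr; apply: lerD => //.
  by rewrite -mulrA ler_wpM2l// ltW.
rewrite (RintegralD measurableT (cst_integrable _ _)); last first.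
  exact: (integrableZl measurableT _ iW1).
rewrite Rintegral_cst//= probability_setT mulr1 RintegralZl//.
rewrite -[leRHS](_ : (c + (c + alpha * value_growth) * C) * W x = _); last by rewrite value_growthE.
rewrite [leRHS]mulrDl lerD2l -mulrA ler_wpM2l//.
  by rewrite addr_ge0// mulr_ge0 ?value_growth_ge0// ltW.
rewrite -lee_fin /Rintegral fineK; first exact: TW.
exact: (integrable_fin_num measurableT iW1).
Qed.

Let has_sup_qvalue x : has_sup (range (qvalue v x)).
Proof.
split; first by exists (qvalue v x point), point.
exists (value_growth * W x) => _ [a _ <-].
exact: le_trans (ler_norm _) (qvalue_growth x a).
Qed.

Lemma qvalue_le_bellman x a : qvalue v x a <= bellman v x.
Proof. by apply: sup_upper_bound => //; exists a. Qed.

Lemma bellman_lipschitz : lipschitz_fun (bellman v) value_lip.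
Proof.
have half x x' : bellman v x <= bellman v x' + value_lip * pdist x x'.
  apply: ge_sup; first by exists (qvalue v x point), point.
  move=> _ [a _ <-]; have := qvalue_lipschitz x a x' a.
  rewrite pdistxx addr0 ler_norml => /andP[_].
  have := qvalue_le_bellman x' a; lra.
move=> x x'; rewrite ler_norml; apply/andP; split.
  by have := half x' x; rewrite (pdistC x'); lra.
by have := half x x'; lra.
Qed.

Lemma bellman_growth x : `|bellman v x| <= value_growth * W x.
Proof.
rewrite ler_norml; apply/andP; split.
  apply: le_trans (qvalue_le_bellman x point).
  by have := qvalue_growth x point; rewrite ler_norml => /andP[].
apply: ge_sup; first by exists (qvalue v x point), point.
move=> _ [a _ <-]; exact: le_trans (ler_norm _) (qvalue_growth x a).
Qed.

(** The Q-value is Lipschitz in the action, so a supremum over all actions is approached along a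
    countable dense sequence. Taking the first action in it that is good enough is measurable in the
    state. *)
Lemma greedy_selector (delta : R) : 0 < delta ->
  exists2 b : SX -> SA, measurable_fun setT b &
    forall x, bellman v x - delta <= qvalue v x (b x).
Proof.
move=> delta0; pose s := dense_seq A0.
pose B i := [set x | bellman v x - delta < qvalue v x (s i)].
have mB i : measurable (B i).
  have mq : measurable_fun setT (fun x => qvalue v x (s i) - bellman v x).
    apply: measurable_funB; last exact: lipschitz_measurable bellman_lipschitz.
    apply: (@lipschitz_measurable _ _ _ _ _ value_lip) => x x'.
    by have := qvalue_lipschitz x (s i) x' (s i); rewrite pdistxx addr0.
  have := mq measurableT _ (measurable_itv `]- delta, +oo[); rewrite setTI.
  congr measurable; apply/seteqP; split => x /=; rewrite in_itv/= andbT /B/= => ?; lra.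
have Bex x : exists i, B i x.
  have delta2 : 0 < delta / 2 by rewrite divr_gt0.
  have [_ [a _ <-] qa] := sup_adherent delta2 (has_sup_qvalue x).
  have L1 : 0 < value_lip + 1 by have := value_lip_ge0; lra.
  have [i ai] := dense_seqP a (divr_gt0 delta2 L1).
  exists i; rewrite /B/=.
  have := qvalue_lipschitz x a x (s i); rewrite pdistxx add0r ler_norml => /andP[_].
  have : value_lip * pdist a (s i) <= delta / 2.
    have : (value_lip + 1) * pdist a (s i) < delta / 2 by rewrite mulrC -ltr_pdivlMr.
    by have := pdist_ge0 a (s i); lra.
  by move: qa; rewrite /bellman; lra.
have [f fB mf] := measurable_first_index mB Bex.
exists (s \o f); last by move=> x; exact/ltW/fB.
(* Every set of indices is measurable, hence so is every function on [nat]. *)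
by apply: measurableT_comp mf; move=> _ Y _; exact: Logic.I.
Qed.

End operator.

Lemma value_iterate_lipschitz k : lipschitz_fun (value_iterate k) value_lip /\
  forall y, `|value_iterate k y| <= value_growth * W y.
Proof.
elim: k => [|k [IH1 IH2]].
  split=> [y y'|y]; rewrite /value_iterate/= ?subrr normr0 mulr_ge0//.
  - exact: value_lip_ge0.
  - exact: pdist_ge0.
  - exact: value_growth_ge0.
by split; [exact: bellman_lipschitz|exact: bellman_growth].
Qed.

End bellman.

(** * Measurability of kernels for the Wasserstein topology *)

Section wasserstein_kernels.
Context {R : realType} {n : nat} {E : set 'rV[R]_n} {E0 : E !=set0}.
Local Notation S := (borel_subspace E0).

Lemma wspace_moment (q : nat) (P : wspace E0 q) : (0 < q)%N -> finite_moment E0 1 P.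
Proof. by move=> q0; apply: (finite_moment_le q0); exact: set_valP. Qed.

Section measurable_evaluation.
Context dT (T : measurableType dT) (K : T -> wspace E0 1).
Hypothesis bK : borel_measurable K.

(** By the duality bound, P -> \int f dP is continuous for the 1-Wasserstein distance, so its
    superlevel sets are open. *)
Lemma lipschitz_integral_measurable (f : S -> R) L : 0 <= L -> lipschitz_fun f L ->
  measurable_fun setT (fun y => \int[K y]_z f z).
Proof.
move=> L0 fL; apply: measurable_fun_gt => c.
have oU : open [set P : wspace E0 1 | c < \int[P]_z f z].
  suff : wass_open [set P : wspace E0 1 | c < \int[P]_z f z] by [].
  move=> P /= cP; have L1 : 0 < L + 1 by lra.
  have Pc0 : 0 < \int[P]_z f z - c by rewrite subr_gt0.
  exists ((\int[P]_z f z - c) / (L + 1)); first by rewrite divr_gt0.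
  set e := _ / _ => Q /ltW PQ.
  have e0 : 0 <= e by rewrite divr_ge0// ltW.
  have := Rintegral_le_wass (ltn0Sn 0) (wspace_moment P (ltn0Sn 0))
    (wspace_moment Q (ltn0Sn 0)) L0 e0 fL PQ.
  have : (L + 1) * e = \int[P]_z f z - c by rewrite /e mulrC divfK// gt_eqF.
  have ep : 0 < e by rewrite divr_gt0.
  by rewrite ler_norml => ? /andP[_]; lra.
exact: bK (sub_sigma_algebra oU).
Qed.

(** The indicator of U is the limit of the Lipschitz functions min(1, k g), where g is the distance
    to the complement of U. *)
Let measurable_open (U : set S) : open U -> measurable_fun setT (fun y => K y U).
Proof.
move=> oU; have mU : measurable U by exact: sub_sigma_algebra.
(* The distance to the complement is meaningful only if the complement is nonempty. *)
have [UT|/set0P [z0 nUz0]] := eqVneq (~` U) set0.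
  have -> : U = setT by rewrite -(setCK U) UT setC0.
  by under eq_fun do rewrite probability_setT; exact: measurable_cst.
pose D x := [set pdist x z | z in ~` U].
pose g x := inf (D x).
have D0 x : D x !=set0 by exists (pdist x z0), z0.
have Dlb x : has_lbound (D x) by exists 0 => _ [z _ <-]; exact: pdist_ge0.
have g0 x : 0 <= g x by apply: lb_le_inf => // _ [z _ <-]; exact: pdist_ge0.
have gU x : U x -> 0 < g x.
  move=> /(open_pdist oU)[e e0 eU]; apply: lt_le_trans e0 _.
  apply: lb_le_inf => // _ [z nUz <-]; rewrite leNgt; apply/negP => xz.
  by apply: nUz; exact: eU.
have gnU x : ~ U x -> g x = 0.
  move=> nUx; apply/eqP; rewrite eq_le g0 andbT.
  by apply: ge_inf => //; exists x => //; rewrite pdistxx.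
have g1 x y : g x <= g y + pdist x y.
  rewrite -lerBlDr; apply: lb_le_inf => // _ [z nUz <-].
  rewrite lerBlDr; apply: (@le_trans _ _ (pdist x z)).
    by apply: ge_inf => //; exists z.
  by rewrite addrC; exact: pdist_triangle.
pose f k x := Num.min 1 (k%:R * g x).
have fle k x y : f k x <= f k y + k%:R * pdist x y.
  have h : k%:R * g x <= k%:R * g y + k%:R * pdist x y.
    by rewrite -mulrDr ler_wpM2l.
  have p0 : 0 <= k%:R * pdist x y by rewrite mulr_ge0// pdist_ge0.
  rewrite /f /Num.min; case: ifPn => h1; case: ifPn => h2; rewrite -?leNgt in h1 h2 *; lra.
have fL k : lipschitz_fun (f k) k%:R.
  move=> x y; rewrite ler_norml; apply/andP; split.
    by have := fle k y x; rewrite (pdistC y); lra.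
  by have := fle k x y; lra.
have f0 k x : 0 <= f k x by rewrite /f le_min ler01/= mulr_ge0.
have f1 k x : f k x <= 1 by rewrite /f ge_min lexx.
have f_cvg x : f ^~ x @ \oo --> (\1_U x : R).
  rewrite indicE; have [xU|] := boolP (x \in U); last first.
    rewrite notin_setE => /gnU gx; apply: cvg_near_cst.
    by apply: nearW => k; rewrite /f gx mulr0 min_r.
  have gx : 0 < g x by apply: gU; rewrite inE in xU.
  apply: cvg_near_cst.
  exists (Num.truncn (g x)^-1).+1 => // k /= kg; apply/eqP.
  rewrite /f min_l// -ler_pdivrMr// mul1r; apply: le_trans (ltW (truncnS_gt _)) _.
  by rewrite ler_nat.
apply: (@emeasurable_fun_cvg _ _ _ _ (fun k y => (\int[K y]_z f k z)%:E)).
  move=> k; apply/measurable_EFinP; exact: lipschitz_integral_measurable (ler0n _ k) (fL k).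
move=> y _.
have mf k : measurable_fun setT (f k) by exact: lipschitz_measurable (fL k).
have [|||||_ _] := @dominated_convergence _ _ _ (K y : probability S R) setT measurableT
  (fun k z => (f k z)%:E) (fun z => (\1_U z)%:E) (cst 1%E).
- by move=> k; exact/measurable_EFinP.
- by apply/measurable_EFinP; exact: measurable_indic.
- by apply: aeW => z _; apply: cvg_EFin; [exact: nearW|exact: f_cvg].
- exact: cst_integrable.
- by apply: aeW => z k _; rewrite gee0_abs lee_fin.
rewrite integral_indic// setIT; apply: cvg_trans; apply: near_eq_cvg.
apply: nearW => k /=; rewrite /Rintegral fineK//.
have Ki := lipschitz_integrable (wspace_moment (K y) (ltn0Sn 0)) (ler0n _ k) (fL k).
exact: (integrable_fin_num measurableT Ki).
Qed.

(** The open sets are stable under intersection and generate the Borel sets, so Dynkin induction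
    applies. This leads from the measurability demanded in [ambiguity_law] to
    [measurable_kernels]. *)
Lemma wspace_kernel_measurable (B : set S) : measurable B ->
  measurable_fun setT (fun y => K y B).
Proof.
apply: (@dynkin_induction _ S (@open S)
  (fun B => measurable_fun setT (fun y => K y B))) => //.
- exact: openI.
- exact/measurable_open/openT.
- move=> A mA mKA.
  have -> : (fun y => K y (~` A)) = (fun y => 1 - K y A)%E.
    by apply/funext => y; rewrite probability_setC.
  by apply: emeasurable_funB.
- move=> F mF tF mKF.
  have -> : (fun y => K y (\bigcup_k F k)) = (fun y => \sum_(k <oo) K y (F k))%E.
    apply/funext => y; apply/esym/cvg_lim => //.
    by apply: measure_semi_sigma_additive => //; exact: bigcupT_measurable.
  by apply: ge0_emeasurable_sum => // k y _ _.
Qed.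

End measurable_evaluation.
End wasserstein_kernels.

Lemma preimage_borel_measurable d (S : measurableType d) (T : topologicalType) (f : S -> T) :
  (forall U : set T, open U -> measurable (f @^-1` U)) -> borel_measurable f.
Proof.
move=> fU; rewrite /borel_measurable.
apply: smallest_sub; last exact: fU.
split => [|A mA|F mF].
- by rewrite /= preimage_set0.
- by rewrite setTD /= preimage_setC; exact: measurableC.
- by rewrite /= preimage_bigcup; exact: bigcupT_measurable.
Qed.

Section lipschitz_kernel.
Context {R : realType} {d m q : nat} {X : set 'rV[R]_d} {A : set 'rV[R]_m}
  {X0 : X !=set0} {A0 : A !=set0}.
Local Notation SX := (borel_subspace X0).
Local Notation SA := (borel_subspace A0).
Context (P : SX -> SA -> wspace X0 q) (L : R) (q0 : (0 < q)%N).
Hypotheses (L0 : 0 <= L) (PL : kernel_lipschitz P L).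

(** Retyped from order q to order 1, as [ambiguity_law] takes its kernels in [wspace X0 1]. *)
Definition kernel_of_control (a : SX -> SA) (y : SX) : wspace X0 1 :=
  SigSub (mem_set (wspace_moment (P y (a y)) q0)).

(* The open set {(y, b) | U (P y b)} is a countable union of sets B * ball(s, 1/k)
   with B closed and s in a dense sequence. *)
Lemma kernel_of_control_measurable (a : SX -> SA) : measurable_fun setT a ->
  borel_measurable (kernel_of_control a).
Proof.
move=> ma; apply: preimage_borel_measurable => U oU.
pose P1 y b := kernel_of_control (cst b) y.
pose s := dense_seq A0.
pose del (k : nat) : R := k.+1%:R^-1.
have del0 k : 0 < del k by rewrite invr_gt0.
pose F k i := [set y | forall y' b', pdist y y' + pdist (s i) b' < 2 * del k -> U (P1 y' b')].
have mF k i : measurable (F k i).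
  rewrite -(setCK (F k i)); apply: measurableC; apply: pdist_open_measurable => y.
  move=> /existsNP[y' /existsNP[b' /not_implyP[yy' nU]]].
  exists (2 * del k - (pdist y y' + pdist (s i) b')); first by rewrite subr_gt0.
  move=> z yz /(_ y' b') Fz; apply: nU; apply: Fz.
  by have := pdist_triangle y z y'; rewrite (pdistC z y); lra.
have mG k i : measurable [set y | pdist (a y) (s i) < del k].
  have := measurableT_comp (pdistr_measurable (s i)) ma.
  move=> /(_ measurableT _ (measurable_itv `]-oo, del k[)); rewrite setTI.
  by congr measurable; apply/seteqP; split => y /=; rewrite in_itv.
rewrite (_ : _ @^-1` U =
    \bigcup_k \bigcup_i (F k i `&` [set y | pdist (a y) (s i) < del k])).
  by apply: bigcupT_measurable => k; apply: bigcupT_measurable => i; exact: measurableI.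
apply/seteqP; split => [y Uy|y [k _ [i _ [Fy /= ay]]]]; last first.
  suff : U (P1 y (a y)) by [].
  by apply: Fy; rewrite pdistxx add0r pdistC; have := del0 k; lra.
have : wass_open U by [].
move=> /(_ _ Uy)[e e0 eU].
(* A pair within 2 del of (y, s i) is within 3 del of (y, a y), and 3 L del < e / 2. Halving e
   leaves room because [wass1_le] concludes with a weak inequality. *)
have L1 : 0 < 6 * (L + 1) by have := L0; lra.
have [k _ /(_ k (leqnn k)) /= ke] := near_infty_natSinv_lt (PosNum (divr_gt0 e0 L1)).
have {}ke : 6 * (L + 1) * del k < e by rewrite mulrC -ltr_pdivlMr.
have [i ai] := dense_seqP (a y) (del0 k).
exists k => //; exists i => //; split => // y' b' yb; apply: eU.
have e20 : 0 < e / 2 by rewrite divr_gt0.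
apply: (@le_lt_trans _ _ (e / 2)%:E); last by rewrite lte_fin; lra.
apply: (wass1_le q0 e20); apply: le_lt_trans (PL _ _ _ _) _; rewrite lte_fin.
have h : pdist y y' + pdist (a y) b' <= 3 * del k.
  by have := pdist_triangle (s i) (a y) b'; lra.
have := ler_wpM2l L0 h; have := del0 k; lra.
Qed.

End lipschitz_kernel.

(** Multiplication by 1 - alpha telescopes the partial sums into those of the geometric series of
    alpha LP, up to the correction alpha u_(k-1). The correction tends to 0 because the monotone
    partial sums are bounded; LP itself may exceed 1. *)
Lemma gap_seriesE (R : realType) (alpha LP : R) : 0 < alpha < 1 -> 0 <= LP ->
  alpha * LP < 1 ->
  gap_series alpha LP = ((1 - alpha)^-1 * (1 - alpha * LP)^-1)%:E.
Proof.
move=> /andP[alpha0 alpha1] LP0 p1; set p := alpha * LP in p1 *.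
have p0 : 0 <= p by rewrite mulr_ge0// ltW.
have a1 : 0 < 1 - alpha by rewrite subr_gt0.
have q1 : 0 < 1 - p by rewrite subr_gt0.
pose u i := alpha ^+ i * \sum_(0 <= j < i.+1) LP ^+ j.
have u0 i : 0 <= u i.
  by rewrite mulr_ge0 ?exprn_ge0 ?(ltW alpha0)// sumr_ge0// => j _; rewrite exprn_ge0.
have telescope k : (1 - alpha) * series u k =
    series (geometric 1 p) k - alpha ^+ k * \sum_(0 <= j < k) LP ^+ j.
  rewrite /series/=; elim: k => [|k IH]; first by rewrite !big_geq// !mulr0 subrr.
  rewrite !big_nat_recr//= mulrDr IH /u /p exprMn exprS.
  by rewrite big_nat_recr//=; ring.
have geo : series (geometric 1 p) @ \oo --> (1 - p)^-1.
  rewrite -[X in _ --> X]mul1r; apply: cvg_geometric_series.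
  by rewrite ger0_norm.
have du : {homo series u : m k / (m <= k)%N >-> m <= k}.
  by apply/nondecreasing_seqP => k; rewrite /series/= big_nat_recr//= lerDl.
have cu : cvgn (series u).
  apply: nondecreasing_is_cvgn => //; exists ((1 - alpha)^-1 * (1 - p)^-1).
  move=> _ [k _ <-]; rewrite ler_pdivlMl// telescope.
  apply: (@le_trans _ _ (series (geometric 1 p) k)).
    rewrite gerBl mulr_ge0 ?exprn_ge0 ?(ltW alpha0)//.
    by rewrite sumr_ge0// => j _; rewrite exprn_ge0.
  rewrite -(cvg_lim _ geo)//; apply: nondecreasing_cvgn_le; last exact: cvgP geo.
  by apply/nondecreasing_seqP => j; rewrite /series/= big_nat_recr//= lerDl mul1r exprn_ge0.
have u_cvg0 : u @ \oo --> 0 by exact: cvg_series_cvg_0.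
have lim_u : series u @ \oo --> (1 - alpha)^-1 * (1 - p)^-1.
  rewrite -cvg_shiftS.
  have -> : [sequence series u k.+1]_k =
      (fun k => (1 - alpha)^-1 * (series (geometric 1 p) k.+1 - alpha * u k)).
    apply/funext => k /=; rewrite /u mulrA -exprS -telescope mulKf// gt_eqF//.
  have h : (fun k => series (geometric 1 p) k.+1 - alpha * u k) @ \oo -->
      (1 - p)^-1 - alpha * 0.
    apply: cvgB; first by rewrite (cvg_shiftS (series (geometric 1 p))).
    by apply: cvgM u_cvg0; exact: cvg_cst.
  rewrite mulr0 subr0 in h.
  by apply: cvgM h; exact: cvg_cst.
rewrite /gap_series; apply/cvg_lim => //.
under eq_cvg do rewrite sumEFin.
by apply: cvg_EFin => //; exact: nearW.
Qed.

(** * The gap between the two value functions *)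

Section value_gap.
Context {R : realType} {d m q : nat} {X : set 'rV[R]_d} {A : set 'rV[R]_m}
  {X0 : X !=set0} {A0 : A !=set0}.
Local Notation SX := (borel_subspace X0).
Local Notation SA := (borel_subspace A0).
Context (q0 : (0 < q)%N) (eps alpha : R) (alpha01 : 0 < alpha < 1).
Context (r : SX -> SA -> SX -> R) (Phat Ptrue : SX -> SA -> wspace X0 q).
Context (Lr LP c C kappa : R) (W : SX -> R).
Hypothesis Lr0 : 0 <= Lr.
Hypothesis rL : forall x a y x' a' y', `|r x a y - r x' a' y'| <=
  Lr * (pdist x x' + pdist a a' + pdist y y').
Hypothesis A4 : true_kernel_assumption Phat Ptrue eps alpha LP.
Hypothesis mW : measurable_fun setT W.
Hypothesis W1 : forall y, 1 <= W y.
Hypothesis C0 : 0 <= C.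
Hypothesis alphaC : alpha * C < 1.
Hypothesis PW : forall x a P, ambiguity Phat eps x a P ->
  (\int[P]_z (W z)%:E <= (C * W x)%:E)%E.
Hypothesis c0 : 0 <= c.
Hypothesis rc : forall x a y, `|r x a y| <= c * (W x + W y).
Hypothesis kappa0 : 0 <= kappa.
(** The only place where the two claims of the theorem differ: kappa is 2 eps in general, and eps if
    the true kernel is the centre. *)
Hypothesis kappaP : forall x a P (f : SX -> R) L, 0 <= L -> lipschitz_fun f L ->
  ambiguity Phat eps x a P ->
  (\int[Ptrue x a]_y f y) - kappa * L <= \int[P]_y f y.

Let alpha0 : 0 < alpha. Proof. by case/andP: alpha01. Qed.

Let W0 y : 0 <= W y. Proof. exact: le_trans (W1 y). Qed.

Let LP0 : 0 <= LP. Proof. by case: A4 => _ /andP[]. Qed.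

Let alphaLP : alpha * LP < 1.
Proof. by case: A4 => _ /andP[_ h] _; rewrite mulrC -ltr_pdivlMr// div1r. Qed.

Let true_ambiguity x a : ambiguity Phat eps x a (Ptrue x a).
Proof. by case: A4. Qed.

Let T x a : probability SX R := Ptrue x a.

Let T1 x a : finite_moment X0 1 (T x a).
Proof. exact: wspace_moment. Qed.

Let TL (f : SX -> R) L : 0 <= L -> lipschitz_fun f L -> forall x a x' a',
  `|(\int[T x a]_y f y) - (\int[T x' a']_y f y)| <=
    L * (LP * (pdist x x' + pdist a a')).
Proof.
move=> L0 fL x a x' a'.
apply: (Rintegral_le_wass q0) => //.
  by rewrite mulr_ge0// addr_ge0// pdist_ge0.
by case: A4 => _ _; exact.
Qed.

Let TW x a : (\int[T x a]_z (W z)%:E <= (C * W x)%:E)%E.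
Proof. exact: PW (true_ambiguity x a). Qed.

Let v := value_iterate T r alpha.
Let vLW k := value_iterate_lipschitz T1 TL Lr0 rL mW W0 TW c0 C0 rc alpha0 LP0
  alphaLP alphaC k.
Let vL k : lipschitz_fun (v k) (value_lip alpha Lr LP) := (vLW k).1.
Let vW k : forall y, `|v k y| <= value_growth alpha c C * W y := (vLW k).2.
Let lambda := target_lip alpha Lr LP.

Let mv k : measurable_fun setT (v k).
Proof. exact: lipschitz_measurable (vL k). Qed.

Let lambda0 : 0 <= lambda. Proof. exact: target_lip_ge0. Qed.

Section fixed_start.
Context (x0 : SX).

Let B := c * (1 + C) * W x0 / (1 - alpha * C).
Let g := alpha * C.

Section fixed_control.
Context (a : nat -> SX -> SA) (ca : control a).
Context (K : nat -> SX -> wspace X0 1).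
Hypothesis bK : forall t, borel_measurable (K t).
Hypothesis Kamb : forall t y, ambiguity Phat eps y (a t y) (K t y).

Let Kp t y : probability SX R := K t y.
Let P := kernel_law x0 Kp.

Let mK : measurable_kernels Kp.
Proof. by move=> t U mU; exact: wspace_kernel_measurable. Qed.

(** [kernel_law] is a [get]; the existence theorem gives the chosen law its defining property. *)
Let PK : is_kernel_law x0 Kp P.
Proof. by apply: getPex; exact: is_kernel_law_exists. Qed.

Let rho t y z := r y (a t y) z.

Let mrho t : measurable_fun setT (fun z : SX * SX => rho t z.1 z.2).
Proof.
apply: (lipschitz3_measurable (g := r) (L := Lr)) => //.
exact: (measurableT_comp (ca t) measurable_fst).
Qed.

Let KW t y : (\int[Kp t y]_z (W z)%:E <= (C * W y)%:E)%E.
Proof. exact: PW (Kamb t y). Qed.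

Let S N := \sum_(0 <= t < N) alpha ^+ t * \int[P]_w rho t (w t) (w t.+1).

Lemma reward_expectation : exists2 e : R,
  ('E_P[total_reward r alpha a])%E = e%:E & forall N, `|e - S N| <= B * g ^+ N.
Proof.
have [e eE eN] := @discounted_expectation _ _ _ _ Kp mK x0 P PK W C mW W1 C0 KW
  rho c alpha mrho c0 (fun t y z => rc y (a t y) z) alpha01 alphaC.
by exists e => //; rewrite unlock.
Qed.

Lemma expected_reward_le N :
  (forall t y (B : set SX), measurable B -> K t y B = T y (a t y) B) -> S N <= v N x0.
Proof.
move=> KT.
apply: (discounted_reward_le mK PK mW W1 C0 KW mrho c0
  (fun t y z => rc y (a t y) z) alpha01 (value_growth_ge0 c0 C0 alphaC) mv vW) => //.
(* As t < N, the index N - t is a successor, and [v (N - t)] unfolds to one Bellman step. *)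
move=> t y tN; rewrite -(subnSK tN).
have -> : \int[Kp t y]_z (rho t y z + alpha * v (N - t.+1) z) =
    qvalue T r alpha (v (N - t.+1)) y (a t y).
  congr fine; apply: eq_measure_integral => U mU _; exact: KT.
rewrite -[v (N - t.+1).+1]/(bellman T r alpha (v (N - t.+1))).
exact: (qvalue_le_bellman T1 Lr0 rL mW W0 TW c0 C0 rc alpha0 alphaLP alphaC (vL _) (vW _)).
Qed.

Lemma expected_reward_ge N (delta : R) : 0 <= delta ->
  (forall t y, (t < N)%N -> v (N - t) y - delta <=
     qvalue T r alpha (v (N - t.+1)) y (a t y)) ->
  v N x0 - (kappa * lambda + delta) / (1 - alpha) <= S N.
Proof.
move=> delta0 greedy.
apply: (discounted_reward_ge mK PK mW W1 C0 KW mrho c0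
  (fun t y z => rc y (a t y) z) alpha01 (value_growth_ge0 c0 C0 alphaC) mv vW) => //.
  by rewrite addr_ge0// mulr_ge0.
move=> t y tN; have := greedy t y tN.
have := kappaP lambda0 (target_lipschitz rL alpha0 alphaLP (vL (N - t.+1)) y (a t y)) (Kamb t y).
rewrite /qvalue /T /target -/(rho t y); lra.
Qed.

End fixed_control.

(** The true law competes in the infimum defining the robust value, whence the lower bound 0 for the
    gap. *)
Lemma true_law_ambiguity a : control a ->
  ambiguity_law Phat eps x0 a (true_law Ptrue x0 a).
Proof.
move=> ca; exists (fun t => kernel_of_control Ptrue q0 (a t)) => // t; split.
  by apply: (kernel_of_control_measurable q0 LP0) => //; case: A4.
by move=> y; exact: true_ambiguity.
Qed.

Lemma true_reward_le a : control a ->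
  exists2 e : R, ('E_(true_law Ptrue x0 a)[total_reward r alpha a])%E = e%:E &
    forall N, e <= v N x0 + B * g ^+ N.
Proof.
move=> ca; pose K t := kernel_of_control Ptrue q0 (a t).
have bK t : borel_measurable (K t).
  by apply: (kernel_of_control_measurable q0 LP0) => //; case: A4.
have Kamb t y : ambiguity Phat eps y (a t y) (K t y) by exact: true_ambiguity.
have [e eE eN] := reward_expectation ca bK Kamb.
exists e => // N; have := eN N; rewrite ler_norml => /andP[_].
have := expected_reward_le ca bK Kamb N (fun t y U _ => erefl); lra.
Qed.

Lemma greedy_reward_ge N (delta : R) : 0 < delta -> exists2 a, control a &
  forall Q, ambiguity_law Phat eps x0 a Q ->
    exists2 e : R, ('E_Q[total_reward r alpha a])%E = e%:E &
      v N x0 - (kappa * lambda + delta) / (1 - alpha) - B * g ^+ N <= e.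
Proof.
move=> delta0.
have /choice[b bP] : forall k, exists b : SX -> SA, measurable_fun setT b /\
    forall y, v k.+1 y - delta <= qvalue T r alpha (v k) y (b y).
  move=> k; have [b mb bk] := greedy_selector T1 TL Lr0 rL mW W0 TW c0 C0 rc alpha0
    LP0 alphaLP alphaC (vL k) (vW k) delta0.
  by exists b.
(* At time t the action is greedy for the value after the transition. From time N on the truncated
   subtraction gives [b 0], and what is earned then is covered by the tail B g^N. *)
pose a t := b (N - t.+1)%N.
have ca : control a by move=> t; exact: (bP _).1.
exists a => // Q [K HK <-].
have [e eE /(_ N)] := reward_expectation ca (fun t => (HK t).1) (fun t => (HK t).2).
rewrite ler_norml => /andP[h _]; exists e => //.
have := @expected_reward_ge a ca K (fun t => (HK t).1) (fun t => (HK t).2) N delta (ltW delta0).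
suff H t y : (t < N)%N -> v (N - t) y - delta <=
    qvalue T r alpha (v (N - t.+1)) y (a t y) by move=> /(_ H); lra.
by move=> tN; rewrite -(subnSK tN); exact: (bP _).2.
Qed.

Lemma value_gap_le :
  (0 <= true_value r Ptrue alpha x0 - robust_value r Phat eps alpha x0
     <= (kappa * lambda / (1 - alpha))%:E)%E.
Proof.
set vt := true_value _ _ _ _; set vr := robust_value _ _ _ _ _.
have a1 : 0 < 1 - alpha by rewrite subr_gt0; case/andP: alpha01.
have vt_le N : (vt <= (v N x0 + B * g ^+ N)%:E)%E.
  apply: ge_ereal_sup => _ [a ca <-].
  by have [e -> eN] := true_reward_le ca; rewrite lee_fin.
have vr_le : (vr <= vt)%E.
  apply: ge_ereal_sup => _ [a ca <-].
  apply: (@le_trans _ _ ('E_(true_law Ptrue x0 a)[total_reward r alpha a])%E).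
    by apply: ereal_inf_lbound; exists (true_law Ptrue x0 a) => //; exact: true_law_ambiguity.
  by apply: ereal_sup_ubound; exists a.
have vr_ge N delta : 0 < delta ->
    ((v N x0 - (kappa * lambda + delta) / (1 - alpha) - B * g ^+ N)%:E <= vr)%E.
  move=> /(greedy_reward_ge N)[a ca aQ].
  apply: (@le_trans _ _ (ereal_inf [set ('E_Q[total_reward r alpha a])%E
                           | Q in ambiguity_law Phat eps x0 a])).
    by apply/ereal_infP => _ [Q /aQ[e -> eN] <-]; rewrite lee_fin.
  by apply: ereal_sup_ubound; exists a.
(* Finiteness of both values turns the difference of extended reals into one of reals. *)
have vtfin : vt \is a fin_num.
  rewrite fin_numElt (le_lt_trans (vt_le 0%N)) ?ltry// andbT.
  by apply: lt_le_trans vr_le; apply: lt_le_trans (vr_ge 0%N 1 ltr01); rewrite ltNyr.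
have vrfin : vr \is a fin_num.
  rewrite fin_numElt (le_lt_trans (le_trans vr_le (vt_le 0%N))) ?ltry// andbT.
  by apply: lt_le_trans (vr_ge 0%N 1 ltr01); rewrite ltNyr.
move: vt_le vr_le vr_ge.
rewrite -(fineK vtfin) -(fineK vrfin) -EFinB !lee_fin subr_ge0 => vt_le -> vr_ge /=.
apply/ler_addgt0Pr => e e0.
(* This delta costs e / 2 after division by 1 - alpha. The two tails, one for each value, cost e / 4
   each. *)
have d0 : 0 < (1 - alpha) * (e / 2) by rewrite mulr_gt0// divr_gt0.
have g01 : `|g| < 1 by rewrite ger0_norm// mulr_ge0// ltW.
have : (geometric B g) @ \oo --> 0 by exact: cvg_geometric.
have e4 : 0 < e / 4 by rewrite divr_gt0.
move=> /cvgrPdist_lt/(_ _ e4)[N _ /(_ N (leqnn N))] /=.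
rewrite sub0r normrN => /(le_lt_trans (ler_norm _)) BN.
have := vt_le N; have := vr_ge N _ d0; rewrite lee_fin lee_fin.
have -> : (kappa * lambda + (1 - alpha) * (e / 2)) / (1 - alpha) =
    kappa * lambda / (1 - alpha) + e / 2 by field; rewrite gt_eqF.
lra.
Qed.

End fixed_start.
End value_gap.

(** * Weight functions for bounded and unbounded rewards *)

Section weights.
Context {R : realType} {d m q : nat} {X : set 'rV[R]_d} {A : set 'rV[R]_m}
  {X0 : X !=set0} {A0 : A !=set0}.
Local Notation SX := (borel_subspace X0).
Local Notation SA := (borel_subspace A0).
Context (q0 : (0 < q)%N) (hA : compact A).
Context (eps alpha : R) (eps0 : 0 < eps) (alpha01 : 0 < alpha < 1).
Context (r : SX -> SA -> SX -> R) (Phat : SX -> SA -> wspace X0 q) (Lr LPhat : R).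
Hypothesis A1 : reward_assumption q r Lr.
Hypothesis A2 : center_assumption r Phat LPhat.
Hypothesis A3 : discount_assumption r Phat eps alpha LPhat.

Lemma ambiguity_integral x a P (f : SX -> R) L : 0 <= L -> lipschitz_fun f L ->
  ambiguity Phat eps x a P ->
  `|(\int[P]_y f y) - (\int[Phat x a]_y f y)| <= L * eps.
Proof.
move=> L0 fL [P1 PPhat]; apply: (Rintegral_le_wass q0) => //; last exact: ltW.
exact: wspace_moment.
Qed.

Let pnorm_Rintegral P : finite_moment X0 1 P ->
  (\int[P]_z (pnorm z)%:E = (\int[P]_z pnorm z)%:E)%E.
Proof.
move=> P1; rewrite /Rintegral fineK//.
exact: (integrable_fin_num measurableT (pnorm_integrable P1)).
Qed.

(** The discount condition forces C_P to be finite, as alpha > 0 and the inverse of +oo is 0. The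
    supremum of infima then gives, for each action, a state that is optimal up to eta; the infimum
    need not be attained. *)
Lemma growth_constE : ~ bounded_reward r -> exists C : R,
  [/\ 1 <= C, LPhat <= C, alpha * C < 1 &
      forall a (eta : R), 0 < eta -> exists x,
        1 + eps + (\int[Phat x a]_z pnorm z) + LPhat * pnorm x < C + eta].
Proof.
move=> unb; have [LPhat0 _] := A2.2 unb.
move: A3; rewrite /discount_assumption /growth_const asboolF//.
set s := ereal_sup _; set G := maxe _ _ => /andP[_ aG].
have s0 : (0 <= s)%E.
  apply: (@le_trans _ _ (ereal_inf [set (\int[Phat x point]_z (pnorm z)%:E +
      (LPhat * pnorm x)%:E)%E | x in [set: SX]])).
    apply/ereal_infP => _ [x _ <-]; apply: adde_ge0.
      by apply: integral_ge0 => z _; rewrite lee_fin pnorm_ge0.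
    by rewrite lee_fin mulr_ge0 ?pnorm_ge0// ltW.
  by apply: ereal_sup_ubound; exists point.
have sG : (1 + eps%:E + s <= G)%E by rewrite /G le_max lexx.
have LG : (LPhat%:E <= G)%E by rewrite /G le_max lexx orbT.
have G1 : (1 <= G)%E.
  by apply: le_trans sG; rewrite -addeA leeDl// adde_ge0// lee_fin ltW.
case: G aG sG LG G1 => [C| |]//=; last first.
  by rewrite invey lte_fin ltNge ltW//; case/andP: alpha01.
move=> aC sC LC C1; rewrite !lee_fin in LC C1.
have C0 : 0 < C by exact: lt_le_trans C1.
exists C; split => //.
  by move: aC; rewrite inver gt_eqF// lte_fin -ltr_pdivlMr// div1r.
move=> a eta eta0.
have : (ereal_inf [set (\int[Phat x a]_z (pnorm z)%:E + (LPhat * pnorm x)%:E)%E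
    | x in [set: SX]] < (C - 1 - eps + eta)%:E)%E.
  apply: (@le_lt_trans _ _ s); first by apply: ereal_sup_ubound; exists a.
  have sfin : s \is a fin_num.
    rewrite ge0_fin_numE//; apply: (@le_lt_trans _ _ C%:E); last by rewrite ltry.
    by apply: le_trans sC; rewrite leeDr// adde_ge0// lee_fin ltW.
  move: sC; rewrite -(fineK sfin) -!EFinD lee_fin lte_fin; lra.
move=> /ereal_inf_lt[_ [x _ <-]].
rewrite pnorm_Rintegral; last exact: wspace_moment.
by rewrite -EFinD lte_fin => h; exists x; lra.
Qed.

Lemma exists_weight : exists (W : SX -> R) (C c : R),
  [/\ measurable_fun setT W, forall y, 1 <= W y,
      [/\ 0 <= C, alpha * C < 1 & 0 <= c],
      forall x a P, ambiguity Phat eps x a P ->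
        (\int[P]_z (W z)%:E <= (C * W x)%:E)%E &
      forall x a y, `|r x a y| <= c * (W x + W y)].
Proof.
have [Lr0 rL _] := A1.
have [[M rM]|unb] := pselect (bounded_reward r).
  exists (cst 1), 1, `|M|; split => //.
  - by split=> //; rewrite mulr1; case/andP: alpha01.
  - by move=> x a P _; rewrite /= integral_cst//= probability_setT mul1e mulr1.
  - move=> x a y; rewrite (le_trans (rM x a y))// (le_trans (ler_norm M))//.
    by rewrite mulrDr mulr1 lerDl.
have [C [C1 LC aC Cx]] := growth_constE unb.
have [LPhat0 PhatL] := A2.2 unb.
have [MA AM] := compact_pdist_bounded A0 hA.
pose p : SX := point; pose b : SA := point.
(* From the Lipschitz bound between (x, a, y) and the reference point (p, b, p). Compactness of A
   bounds the action term by [MA]. *)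
pose c := `|r p b p| + Lr * (2 * pnorm p + MA) + Lr.
have MA0 : 0 <= MA by apply: le_trans (AM b b); exact: pdist_ge0.
have pp0 : 0 <= pnorm p by exact: pnorm_ge0.
have Lc : 0 <= Lr * (2 * pnorm p + MA) by rewrite mulr_ge0 ?(ltW Lr0)// addr_ge0// mulr_ge0.
exists (fun y => 1 + pnorm y), C, c; split.
- by apply: measurable_funD => //; exact: pnorm_measurable.
- by move=> y; rewrite lerDl pnorm_ge0.
- by split => //; [lra|rewrite /c !addr_ge0// ltW].
- move=> x a P PP; have [P1 _] := PP.
  have mp : measurable_fun setT (fun z : SX => (pnorm z)%:E).
    by apply/measurable_EFinP; exact: pnorm_measurable.
  under eq_integral do rewrite EFinD.
  rewrite ge0_integralD//; last by move=> z _; rewrite lee_fin pnorm_ge0.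
  rewrite integral_cst//= probability_setT mul1e pnorm_Rintegral// -EFinD lee_fin.
  (* This is where the form of C_P comes from. Passing from P to the centre at (x, a) costs eps, and
     on to the centre at (x', a) costs LPhat |x - x'| <= LPhat |x| + LPhat |x'|. The terms in x'
     make up C + eta, and LPhat |x| <= C |x|. *)
  apply/ler_addgt0Pr => eta eta0; have [x' hx'] := Cx a eta eta0.
  have := ambiguity_integral ler01 pnorm_lipschitz PP.
  have w0 : 0 <= LPhat * (pdist x x' + pdist a a).
    by rewrite mulr_ge0 ?(ltW LPhat0)// addr_ge0// pdist_ge0.
  have := Rintegral_le_wass q0 (wspace_moment (Phat x a) q0)
    (wspace_moment (Phat x' a) q0) ler01 w0 pnorm_lipschitz (PhatL x a x' a).
  rewrite pdistxx addr0 !mul1r !ler_norml => /andP[_ h1] /andP[_ h2].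
  have h3 : LPhat * pdist x x' <= LPhat * pnorm x + LPhat * pnorm x'.
    by rewrite -mulrDr ler_wpM2l ?(ltW LPhat0)// pdist_le_pnorm.
  have h4 : LPhat * pnorm x <= C * pnorm x by rewrite ler_wpM2r// pnorm_ge0.
  by rewrite mulrDr mulr1; lra.
- move=> x a y; have := rL x a y p b p; set rr := r x a y; set r0 := r p b p => h.
  have h1 : `|rr| <= `|r0| + `|rr - r0|.
    by have := ler_normD r0 (rr - r0); rewrite addrC subrK.
  have h2 : Lr * (pdist x p + pdist a b + pdist y p) <=
      Lr * (2 * pnorm p + MA) + Lr * (pnorm x + pnorm y).
    rewrite -mulrDr ler_wpM2l ?(ltW Lr0)//.
    by have := pdist_le_pnorm x p; have := pdist_le_pnorm y p; have := AM a b; lra.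
  have px := pnorm_ge0 x; have py := pnorm_ge0 y.
  have h3 : 0 <= (`|r0| + Lr * (2 * pnorm p + MA)) * (1 + pnorm x + pnorm y).
    by rewrite mulr_ge0 ?addr_ge0.
  have r00 := normr_ge0 r0.
  by rewrite /c -/r0; lra.
Qed.

End weights.

Theorem theorem3p1 (R : realType) (d m q : nat)
  (hd : (0 < d)%N) (hm : (0 < m)%N) (hq : (0 < q)%N)
  (X : set 'rV[R]_d) (A : set 'rV[R]_m)
  (X0 : X !=set0) (A0 : A !=set0) (hX : closed X) (hA : compact A)
  (eps alpha : R) (heps : 0 < eps) (halpha : 0 < alpha < 1)
  (r : borel_subspace X0 -> borel_subspace A0 -> borel_subspace X0 -> R)
  (Phat Ptrue : borel_subspace X0 -> borel_subspace A0 -> wspace X0 q)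
  (Lr LPhat LP : R)
  (A1 : reward_assumption q r Lr)
  (A2 : center_assumption r Phat LPhat)
  (A3 : discount_assumption r Phat eps alpha LPhat)
  (A4 : true_kernel_assumption Phat Ptrue eps alpha LP) :
  (forall x0 : borel_subspace X0,
     (0 <= true_value r Ptrue alpha x0 - robust_value r Phat eps alpha x0
        <= (2 * Lr * eps * (1 + alpha))%:E * gap_series alpha LP)%E /\
     ((2 * Lr * eps * (1 + alpha))%:E * gap_series alpha LP < +oo)%E) /\
  (kernel_eq Ptrue Phat ->
   forall x0 : borel_subspace X0,
     (0 <= true_value r Ptrue alpha x0 - robust_value r Phat eps alpha x0
        <= (Lr * eps * (1 + alpha))%:E * gap_series alpha LP)%E /\
     ((Lr * eps * (1 + alpha))%:E * gap_series alpha LP < +oo)%E).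
Proof.
have [W [C [c [mW W1 [C0 aC c0] PW rc]]]] := exists_weight hq hA heps halpha A1 A2 A3.
have [Lr0 rL _] := A1; have [PtrueP /andP[LP0 LPa] _] := A4.
have alpha0 : 0 < alpha by case/andP: halpha.
have aLP : alpha * LP < 1 by rewrite mulrC -ltr_pdivlMr// div1r.
have a1 : 0 < 1 - alpha by rewrite subr_gt0; case/andP: halpha.
have p1 : 0 < 1 - alpha * LP by rewrite subr_gt0.
have gap kappa x0 : 0 <= kappa ->
    (forall x a P (f : borel_subspace X0 -> R) L, 0 <= L -> lipschitz_fun f L ->
      ambiguity Phat eps x a P ->
      (\int[Ptrue x a]_y f y) - kappa * L <= \int[P]_y f y) ->
    (0 <= true_value r Ptrue alpha x0 - robust_value r Phat eps alpha x0
       <= (kappa * Lr * (1 + alpha))%:E * gap_series alpha LP)%E /\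
    ((kappa * Lr * (1 + alpha))%:E * gap_series alpha LP < +oo)%E.
  move=> kappa0 kappaP; rewrite gap_seriesE// -EFinM ltry; split=> //.
  have := value_gap_le hq halpha (ltW Lr0) rL A4 mW W1 C0 aC PW c0 rc kappa0 kappaP x0.
  congr (_ <= _ <= _%:E)%E; rewrite /target_lip; field.
  by rewrite !gt_eqF.
split=> [x0|PP x0].
  rewrite (_ : 2 * Lr * eps * (1 + alpha) = 2 * eps * Lr * (1 + alpha)); last by ring.
  apply: gap; first by rewrite mulr_ge0// ltW.
  move=> x a P f L L0 fL PPhat.
  have := ambiguity_integral hq heps L0 fL PPhat.
  have := ambiguity_integral hq heps L0 fL (PtrueP x a).
  by rewrite !ler_norml => /andP[_ ?] /andP[? _]; lra.
rewrite (_ : Lr * eps = eps * Lr); last by rewrite mulrC.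
apply: gap; first exact: ltW.
move=> x a P f L L0 fL PPhat.
have := ambiguity_integral hq heps L0 fL PPhat.
have -> : \int[Ptrue x a]_y f y = \int[Phat x a]_y f y.
  by congr fine; apply: eq_measure_integral => B mB _; exact: PP.
by rewrite !ler_norml => /andP[? _]; lra.
Qed.
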